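(* For every natural number $N\ge 1$ there are $\Delta^1_1$-recursive functions $u,v:\mathcal{N}\times\mathcal{N}\to\mathcal{N}$ such that for all $\alpha,\beta\in\mathcal{N}$, if the analytic sets $G_1^{\mathbb{R}^N}(\alpha)$, $G_1^{\mathbb{R}^N}(\beta)$ are disjoint and $G_1^{\mathbb{R}^N}(\alpha)$ is convex, then there is a convexly generated set $C\subseteq\mathbb{R}^N$ which separates $G_1^{\mathbb{R}^N}(\alpha)$ from $G_1^{\mathbb{R}^N}(\beta)$ (that is, $G_1^{\mathbb{R}^N}(\alpha)\subseteq C$ and $C\cap G_1^{\mathbb{R}^N}(\beta)=\emptyset$), and (i) $u(\alpha,\beta)$ is a Borel code for $C$; (ii) $v(\alpha,\beta)$ is a convexly generated code for $C$.
   Context: Coding conventions. $\mathcal{N}=\omega^\omega$. For a finite sequence of naturals, $\langle u_0,\dots,u_{n-1}\rangle=p_0^{u_0+1}\cdots p_{n-1}^{u_{n-1}+1}$, where $(p_n)$ enumerates the primes in increasing order, $\langle\emptyset\rangle=1$. If $s=\langle u_0,\dots,u_{n-1}\rangle$ and $i<n$ then $(s)_i=u_i$; in all other cases $(s)_i=0$. Put $q(s)=(s)_0/((s)_1+1)$. For $\alpha\in\mathcal{N}$, $\alpha^*(t)=\alpha(t+1)$. Spaces. A recursive Polish space $\mathcal{X}$ (such as $\omega$, $\mathcal{N}$, $\mathbb{R}$ and finite products) comes with a fixed complete metric $d_{\mathcal{X}}$ and a fixed recursive presentation $(r^{\mathcal{X}}_i)_{i\in\omega}$ (a dense sequence for which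 the relations $d(r_i,r_j)<q(k)$, $d(r_i,r_j)\le q(k)$ are recursive); finite products carry the maximum metric and $r^{\mathcal{X}_0\times\dots\times\mathcal{X}_n}_s=(r^{\mathcal{X}_0}_{(s)_0},\dots,r^{\mathcal{X}_n}_{(s)_n})$. $N(\mathcal{X},s)$ is the open ball with center $r^{\mathcal{X}}_{(s)_0}$ and radius $q((s)_1)$. A function $f:\mathcal{X}\to\mathcal{Y}$ is $\Delta^1_1$-recursive if the relation $\{(x,s): f(x)\in N(\mathcal{Y},s)\}$ is (lightface) $\Delta^1_1$. Universal sets. $U^{\mathcal{X}}(\alpha)=\bigcup_nN(\mathcal{X},\alpha(n))$, $F^{\mathcal{X}}(\alpha)=\mathcal{X}\setminus U^{\mathcal{X}}(\alpha)$, $G_1^{\mathcal{X}}(\alpha)=\{x:\exists\gamma\in\mathcal{N}\ (x,\gamma)\in F^{\mathcal{X}\times\mathcal{N}}(\alpha)\}$. For $\alpha\in\mathcal{N}$, $\{\alpha\}:\omega\rightharpoonup\mathcal{N}$ is the partial function such that $\{\alpha\}(n)$ is defined iff there is a unique $y\in\mathcal{N}$ with $y\in N(\mathcal{N},s)\iff(n,s)\in U^{\omega\times\omega}(\alpha)$ for all $s\in\omega$, and then $\{\alpha\}(n)=y$. Borel codes. $\alpha\in BC_0$ iff $\alpha(0)=0$; for $\xi>0$, $\alpha\in BC_\xi$ iff $\alpha(0)=1$ and for all $n$, $\{\alpha^*\}(n)$ is defined and belongs to $BC_\eta$ for some $\eta<\xi$. $BC=\bigcup_{\xi<\omega_1}BC_\xi$.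 For $\alpha\in BC$, the coded Borel subset $\pi c(\alpha)$ of $\mathcal{X}$ (here $\mathcal{X}=\mathbb{R}^N$) is $\mathcal{X}\setminus N(\mathcal{X},\alpha(1))$ if $\alpha(0)=0$, and $\bigcup_n(\mathcal{X}\setminus\pi c(\{\alpha^*\}(n)))$ if $\alpha(0)=1$. $\alpha$ is a Borel code for $\pi c(\alpha)$. Convexly generated sets and codes. A subset of $\mathbb{R}^N$ is convexly generated if it belongs to the least family that contains all compact convex sets and is closed under countable increasing unions and countable intersections. The codes $CGC^N_\xi$ and the coding map $\pi^N$ are defined simultaneously by recursion: $CGC^N_0=\{\alpha:\alpha(0)=0$ and $F^{\mathbb{R}^N}(\alpha^* )$ is compact and convex$\}$ with $\pi^N(\alpha)=F^{\mathbb{R}^N}(\alpha^* )$; for $\xi\ge1$, $\alpha\in CGC^N_\xi$ iff $\alpha(0)=1$, for all $i,j$ $\{\alpha^*\}(\langle i,j\rangle)$ is defined and belongs to $CGC^N_\eta$ for some $\eta<\xi$, and for all $i\le i'$, $\bigcap_j\pi^N(\{\alpha^*\}(\langle i,j\rangle))\subseteq\bigcap_j\pi^N(\{\alpha^*\}(\langle i',j\rangle))$; in this case $\pi^N(\alpha)=\bigcup_i\bigcap_j\pi^N(\{\alpha^*\}(\langle i,j\rangle))$. $CGC^N=\bigcup_{\xi<\omega_1}CGC^N_\xi$, and $\alpha\in CGC^N$ is a convexly generated code for $\pi^N(\alpha)$. *)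

(* Defs.v *)
From HB Require Import structures.
From mathcomp Require Import all_boot all_order all_algebra.
From mathcomp Require Import all_classical all_reals all_analysis.
From mathcomp Require wochoice.

Set Implicit Arguments.
Unset Strict Implicit.
Unset Printing Implicit Defensive.

Import Order.TTheory GRing.Theory Num.Theory.
Import numFieldNormedType.Exports.

Local Open Scope classical_set_scope.
Local Open Scope ring_scope.

Lemma ex_prime_above (m : nat) : exists p, ((m < p) && prime p)%N.
Proof. by have [p mp pp] := prime_above m; exists p; rewrite mp pp. Qed.

Fixpoint nth_prime (n : nat) : nat :=
  if n is m.+1 then ex_minn (ex_prime_above (nth_prime m)) else 2%N.

Definition seqcode (u : seq nat) : nat :=
  (\prod_(i < size u) nth_prime i ^ (nth 0 u i).+1)%N.

(* [seqcode] is injective; [xget] returns the empty sequence if [s] is not a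
   code, so that [(s)_i = 0] outside the two conditions [s = <u>], [i < |u|]. *)
Definition seqdecode (s : nat) : seq nat :=
  xget [::] [set u : seq nat | seqcode u = s].

Definition proj (s i : nat) : nat := nth 0%N (seqdecode s) i.

Definition q {R : realType} (s : nat) : R := (proj s 0)%:R / (proj s 1).+1%:R.

Inductive recursive : forall k, (k.-tuple nat -> nat) -> Prop :=
| recursive_cst k (c : nat) : recursive (fun _ : k.-tuple nat => c)
| recursive_succ : recursive (fun x : 1.-tuple nat => (thead x).+1)
| recursive_proj k (i : 'I_k) : recursive (fun x : k.-tuple nat => tnth x i)
| recursive_comp k m (f : m.-tuple nat -> nat) (g : 'I_m -> k.-tuple nat -> nat) :
    recursive f -> (forall i, recursive (g i)) ->
    recursive (fun x => f [tuple g i x | i < m])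
| recursive_prim k (f : k.-tuple nat -> nat) (g : k.+2.-tuple nat -> nat)
    (h : k.+1.-tuple nat -> nat) :
    recursive f -> recursive g ->
    (forall x : k.-tuple nat, h [tuple of 0%N :: x] = f x) ->
    (forall n (x : k.-tuple nat),
       h [tuple of n.+1 :: x] = g [tuple of n :: h [tuple of n :: x] :: x]) ->
    recursive h
| recursive_mu k (f : k.+1.-tuple nat -> nat) (g : k.-tuple nat -> nat) :
    recursive f ->
    (forall x : k.-tuple nat, f [tuple of g x :: x] = 0%N /\
       forall m, (m < g x)%N -> f [tuple of m :: x] <> 0%N) ->
    recursive g.

(* Only the data used by the coding (a metric and an enumerated dense sequence)
   are recorded: the spaces below are the concrete ones, for which completeness,
   density and the recursiveness conditions are theorems, not choices. *)
Record pspace (R : realType) := PSpace {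
  point_of :> Type;
  pdist : point_of -> point_of -> R;
  center : nat -> point_of }.

Definition omegaSpace (R : realType) : pspace R :=
  @PSpace R nat (fun i j => (i != j)%:R) id.

Definition baire : Type := nat -> nat.

(* 1 / (k + 1) where [k] is the least argument at which the points differ *)
Definition baire_dist {R : realType} (a b : baire) : R :=
  if pselect (exists n, a n != b n) is left h then ((ex_minn h).+1%:R)^-1 else 0.

Definition BaireSpace (R : realType) : pspace R :=
  @PSpace R baire baire_dist (fun s => proj s).

Definition real_center {R : realType} (s : nat) : R :=
  (-1) ^+ proj s 0 * (proj s 1)%:R / (proj s 2).+1%:R.

(* the norm of ['rV[R]_N] is the maximum norm *)
Definition RealSpace (R : realType) (N : nat) : pspace R :=
  @PSpace R 'rV[R]_N (fun x y => `|x - y|)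
    (fun s => \row_(i < N) real_center (proj s i)).

Definition pprod (R : realType) (X Y : pspace R) : pspace R :=
  @PSpace R (X * Y)%type
    (fun a b => Num.max (pdist a.1 b.1) (pdist a.2 b.2))
    (fun s => (center X (proj s 0), center Y (proj s 1))).

Definition nball (R : realType) (X : pspace R) (s : nat) : set X :=
  [set x | pdist (center X (proj s 0)) x < q (proj s 1)].
Arguments nball {R} X.

Definition Uset (R : realType) (X : pspace R) (a : baire) : set X :=
  \bigcup_n nball X (a n).
Arguments Uset {R} X.

Definition Fset (R : realType) (X : pspace R) (a : baire) : set X :=
  ~` Uset X a.
Arguments Fset {R} X.

Definition G1set (R : realType) (X : pspace R) (a : baire) : set X :=
  [set x | exists g : baire, Fset (pprod X (BaireSpace R)) a (x, g)].
Arguments G1set {R} X.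

Definition recursive_point (a : baire) : Prop :=
  recursive (fun x : 1.-tuple nat => a (thead x)).

(* Semirecursive open sets are the [Uset X e] with [e] recursive, hence lightface
   Sigma^1_1 sets, the projections along Baire space of their complements, are
   the [G1set X e] with [e] recursive. *)
Definition Sigma11 (R : realType) (X : pspace R) (A : set X) : Prop :=
  exists2 e : baire, recursive_point e & A = G1set X e.

Definition Delta11 (R : realType) (X : pspace R) (A : set X) : Prop :=
  Sigma11 A /\ Sigma11 (~` A).

Definition Delta11_recursive (R : realType) (X Y : pspace R) (f : X -> Y) : Prop :=
  @Delta11 R (pprod X (omegaSpace R)) [set z | nball Y z.2 (f z.1)].

Definition shift (a : baire) : baire := fun t => a t.+1.

(* [pval R a n y]: {a}(n) is defined and equals y *)
Definition pval (R : realType) (a : baire) (n : nat) (y : baire) : Prop :=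
  unique (fun y : baire => forall s : nat,
    nball (BaireSpace R) s y <-> Uset (pprod (omegaSpace R) (omegaSpace R)) a (n, s)) y.

(* A well-order [W] of nat (as a reflexive relation) and [x : nat] represent the
   order type of the [W]-predecessors of [x]. The ordinals so represented are
   exactly those below omega_1, and those below it are represented by the
   predecessors of [x] in the same [W]. *)
Definition ord_zero (W : rel nat) (x : nat) : Prop := forall y, W x y.

Definition ord_lt (W : rel nat) (y x : nat) : bool := W y x && (y != x).

Inductive BC_stage (R : realType) (W : rel nat) : nat -> baire -> Prop :=
| BC_stage_zero x a : ord_zero W x -> a 0%N = 0%N -> BC_stage R W x a
| BC_stage_pos x a (b : nat -> baire) (y : nat -> nat) :
    ~ ord_zero W x -> a 0%N = 1%N ->
    (forall n, pval R (shift a) n (b n)) ->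
    (forall n, ord_lt W (y n) x) ->
    (forall n, BC_stage R W (y n) (b n)) ->
    BC_stage R W x a.

Definition BC (R : realType) (a : baire) : Prop :=
  exists W : rel nat, wochoice.well_order W /\ exists x, BC_stage R W x a.

(* graph of the map [pi c] *)
Inductive borel_set_of (R : realType) (X : pspace R) : baire -> set X -> Prop :=
| borel_set_of_zero a : a 0%N = 0%N -> borel_set_of a (~` nball X (a 1%N))
| borel_set_of_one a (b : nat -> baire) (B : nat -> set X) :
    a 0%N = 1%N ->
    (forall n, pval R (shift a) n (b n)) ->
    (forall n, borel_set_of (b n) (B n)) ->
    borel_set_of a (\bigcup_n ~` B n).
Arguments borel_set_of {R} X.

Definition Borel_code (R : realType) (X : pspace R) (a : baire) (A : set X) : Prop :=
  BC R a /\ borel_set_of X a A.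
Arguments Borel_code {R} X.

Inductive convexly_generated (R : realType) (N : nat) : set 'rV[R]_N -> Prop :=
| cg_compact (A : set 'rV[R]_N) : compact A -> convex_set A -> convexly_generated A
| cg_union (A : nat -> set 'rV[R]_N) :
    (forall i, convexly_generated (A i)) ->
    (forall i j, (i <= j)%N -> A i `<=` A j) ->
    convexly_generated (\bigcup_i A i)
| cg_inter (A : nat -> set 'rV[R]_N) :
    (forall i, convexly_generated (A i)) ->
    convexly_generated (\bigcap_i A i).

(* [CGC_stage W x a A]: the code [a] belongs to CGC^N at the ordinal given by
   [(W, x)], and pi^N(a) = A *)
Inductive CGC_stage (R : realType) (N : nat) (W : rel nat) :
    nat -> baire -> set 'rV[R]_N -> Prop :=
| CGC_stage_zero x a :
    ord_zero W x -> a 0%N = 0%N ->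
    compact (Fset (RealSpace R N) (shift a) : set 'rV[R]_N) ->
    convex_set (Fset (RealSpace R N) (shift a) : set 'rV[R]_N) ->
    CGC_stage W x a (Fset (RealSpace R N) (shift a))
| CGC_stage_pos x a (b : nat -> nat -> baire) (y : nat -> nat -> nat)
    (D : nat -> nat -> set 'rV[R]_N) :
    ~ ord_zero W x -> a 0%N = 1%N ->
    (forall i j, pval R (shift a) (seqcode [:: i; j]) (b i j)) ->
    (forall i j, ord_lt W (y i j) x) ->
    (forall i j, CGC_stage W (y i j) (b i j) (D i j)) ->
    (forall i i', (i <= i')%N -> \bigcap_j D i j `<=` \bigcap_j D i' j) ->
    CGC_stage W x a (\bigcup_i \bigcap_j D i j).

Definition CG_code (R : realType) (N : nat) (a : baire) (A : set 'rV[R]_N) : Prop :=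
  exists W : rel nat, wochoice.well_order W /\ exists x, CGC_stage W x a A.

(* Main.v *)
Require Import Defs.
From mathcomp Require Import all_boot all_order all_algebra.
From mathcomp Require Import all_classical all_reals all_analysis.
From mathcomp Require Import lra ring zify.
From mathcomp Require wochoice.
Import Order.TTheory GRing.Theory Num.Theory.
Import numFieldNormedType.Exports.
(* again, since [proj] is also a name of the analysis library *)
Import Defs.
Local Open Scope classical_set_scope.
Local Open Scope ring_scope.

Set Implicit Arguments.
Unset Strict Implicit.
Unset Printing Implicit Defensive.

(** Write [A] and [B] for the two analytic sets, and describe a point together with a
witness in Baire space by a sequence [s] of numbers, so that membership in the closed
set means that no finite part of [s] is visibly covered by a ball of the complement
([alive]).  Index [A] by pointwise bounds, [P u = {x : x is described by some s <= u}],
and [B] by prefixes, [Q v = {x : x is described by some s extending v}], for finite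
sequences [u], [v] of the same length.  Then [P u] is the increasing union of the
[P (u k)], and [Q v] is the union of the [Q (v l)], so sets [C (u k) (v l)] that
separate [P (u k)] from [Q (v l)] yield the separating set
[C u v = U_i cap_(k >= i) cap_l C (u k) (v l)].

The recursion stops when rational approximations of [P u] and [Q v] are separated by a
rational hyperplane, which is decidable; then a half-space intersected with a box
separates.  It stops along every path: a path gives a compact subset [K] of [A] and a
point [b] outside [A]; by Caratheodory the convex hull of [K] is compact, hence
strictly separated from [b], and by Koenig's lemma this is seen at a finite stage.

The code of a node lists the balls that contain the codes of its children, so it can
be computed by course-of-values recursion without a fixed-point theorem: the list may
wait until the required values of the children have been computed.  The resulting
functions are recursive in [alpha] and [beta] on all pairs, and values on pairs that
violate the hypotheses are irrelevant. *)

(** * Recursive functions *)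

(* A context of [k] variables.  The variable bound last comes last, and is the head of
   the corresponding tuple. *)
Fixpoint ctx k : Type := if k is k'.+1 then (ctx k' * nat)%type else unit.

Fixpoint env k : k.-tuple nat -> ctx k :=
  match k with
  | 0 => fun _ => tt
  | k'.+1 => fun t => (env [tuple of behead t], thead t)
  end.

Lemma env_cons k m (x : k.-tuple nat) : env [tuple of m :: x] = (env x, m).
Proof.
rewrite /=; congr (_, _).
by congr env; apply: val_inj.
Qed.

Definition rec k (f : ctx k -> nat) : Prop := recursive (fun t => f (env t)).

Lemma rec_ext k (f g : ctx k -> nat) : f =1 g -> rec f -> rec g.
Proof. by move=> fg; rewrite /rec; have -> : f = g by apply: funext. Qed.

Lemma rec_cst k (c : nat) : rec (fun _ : ctx k => c).
Proof. exact: recursive_cst. Qed.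

Lemma rec_var0 k : rec (fun x : ctx k.+1 => x.2).
Proof.
rewrite /rec; have := @recursive_proj k.+1 ord0.
by congr recursive; apply: funext => t; rewrite /= /thead.
Qed.

Lemma recursive_tuple m k (f : m.-tuple nat -> nat)
    (G : k.-tuple nat -> m.-tuple nat) :
  recursive f -> (forall i, recursive (fun x => tnth (G x) i)) ->
  recursive (fun x => f (G x)).
Proof.
move=> rf rG; have := recursive_comp rf rG.
congr recursive; apply: funext => x; congr f.
by apply: eq_from_tnth => i; rewrite tnth_mktuple.
Qed.

Lemma rec_weak k (f : ctx k -> nat) : rec f -> rec (fun x : ctx k.+1 => f x.1).
Proof.
move=> rf; apply: (@recursive_tuple k k.+1 _ (fun t => [tuple of behead t]) rf).
move=> i; have := @recursive_proj k.+1 (lift ord0 i).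
by congr recursive; apply: funext => t; rewrite tnth_behead; congr tnth; apply: val_inj;
  rewrite /= inordK // ltnS.
Qed.

Lemma rec_let k (F : ctx k.+1 -> nat) (g : ctx k -> nat) :
  rec F -> rec g -> rec (fun x => F (x, g x)).
Proof.
move=> rF rg; have := @recursive_tuple k.+1 k _
  (fun t => [tuple of g (env t) :: t]) rF _.
rewrite /rec; under eq_fun do rewrite env_cons; apply => i.
have [j ->|->] := unliftP ord0 i.
- have := @recursive_proj k j; congr recursive.
  by apply: funext => t; rewrite tnthS.
- by move: rg; congr recursive; apply: funext => t; rewrite tnth0.
Qed.

(** In the step of [rec_prim] the variable below the head is the accumulator, which a predicate of
    the counter alone does not mention. *)
Lemma rec_skip k (F : ctx k.+1 -> nat) : rec F ->
  rec (fun x : ctx k.+2 => F (x.1.1, x.2)).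
Proof.
move=> rF; have := @recursive_tuple k.+1 k.+2 _
  (fun t => [tuple of thead t :: behead [tuple of behead t]]) rF _.
rewrite /rec; under eq_fun do rewrite env_cons; apply => i.
have [j ->|->] := unliftP ord0 i.
- have := @recursive_proj k.+2 (lift ord0 (lift ord0 j)).
  congr recursive; apply: funext => t.
  by rewrite tnthS !(tnth_nth 0%N) /= !nth_behead.
- by have := @recursive_proj k.+2 ord0; congr recursive.
Qed.

Definition rec1 (f : nat -> nat) := rec (fun x : ctx 1 => f x.2).
Definition rec2 (f : nat -> nat -> nat) := rec (fun x : ctx 2 => f x.1.2 x.2).

Lemma rec_comp1 f k (g : ctx k -> nat) : rec1 f -> rec g -> rec (fun x => f (g x)).
Proof.
move=> rf rg; apply: (@recursive_tuple 1 k _ (fun t => [tuple g (env t)]) rf) => i.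
by rewrite ord1.
Qed.

Lemma rec_comp2 f k (g h : ctx k -> nat) : rec2 f -> rec g -> rec h ->
  rec (fun x => f (g x) (h x)).
Proof.
move=> rf rg rh.
apply: (@recursive_tuple 2 k _ (fun t => [tuple h (env t); g (env t)]) rf) => i.
by case: i => [[|[|//]] hi].
Qed.

Lemma rec_prim k (f B : ctx k -> nat) (G : ctx k -> nat -> nat -> nat) :
  rec f -> rec (fun x : ctx k.+2 => G x.1.1 x.2 x.1.2) -> rec B ->
  rec (fun x => nat_rec (fun _ => nat) (f x) (G x) (B x)).
Proof.
move=> rf rG rB.
suff rH : rec (fun y : ctx k.+1 => nat_rec (fun _ => nat) (f y.1) (G y.1) y.2).
  exact: (rec_let rH rB).
apply: (recursive_prim rf rG) => [x|n x].
- by rewrite env_cons.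
- by rewrite !env_cons.
Qed.

Lemma rec_S k (f : ctx k -> nat) : rec f -> rec (fun x => (f x).+1).
Proof. by apply: rec_comp1; exact: recursive_succ. Qed.

Create HintDb rec discriminated.
#[local] Hint Resolve rec_cst rec_var0 rec_S : rec.

Lemma rec_var1 k : rec (fun x : ctx k.+2 => x.1.2).
Proof. exact: (rec_weak (rec_var0 _)). Qed.
Lemma rec_var2 k : rec (fun x : ctx k.+3 => x.1.1.2).
Proof. exact: (rec_weak (rec_var1 _)). Qed.
Lemma rec_var3 k : rec (fun x : ctx k.+4 => x.1.1.1.2).
Proof. exact: (rec_weak (rec_var2 _)). Qed.
Lemma rec_var4 k : rec (fun x : ctx k.+4.+1 => x.1.1.1.1.2).
Proof. exact: (rec_weak (rec_var3 _)). Qed.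
#[local] Hint Resolve rec_var1 rec_var2 rec_var3 rec_var4 : rec.

Ltac rec_auto := auto 100 with rec nocore.

Lemma rec_add k (f g : ctx k -> nat) : rec f -> rec g -> rec (fun x => f x + g x)%N.
Proof.
move=> rf rg.
have := @rec_prim k f g (fun _ _ a => a.+1) rf _ rg.
move=> H; apply: rec_ext (H _); last by rec_auto.
by move=> x; elim: (g x) => [|n /= ->]; rewrite ?addn0 ?addnS.
Qed.

Lemma rec_pred k (f : ctx k -> nat) : rec f -> rec (fun x => (f x).-1).
Proof.
move=> rf; have := @rec_prim k (fun _ => 0%N) f (fun _ m _ => m) _ _ rf.
move=> H; apply: rec_ext (H _ _); try by rec_auto.
by move=> x /=; case: (f x).
Qed.

Lemma rec_sub k (f g : ctx k -> nat) : rec f -> rec g -> rec (fun x => f x - g x)%N.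
Proof.
move=> rf rg; have := @rec_prim k f g (fun _ _ a => a.-1) rf _ rg.
move=> H; apply: rec_ext (H _); last by apply: rec_pred; rec_auto.
by move=> x; elim: (g x) => [|n /= ->]; rewrite ?subn0 ?subnS.
Qed.

Lemma rec_mul k (f g : ctx k -> nat) : rec f -> rec g -> rec (fun x => f x * g x)%N.
Proof.
move=> rf rg; have := @rec_prim k (fun _ => 0%N) g (fun x _ a => a + f x)%N _ _ rg.
move=> H; apply: rec_ext (H _ _); try by rec_auto.
- by move=> x; elim: (g x) => [|n /= ->]; rewrite ?muln0 // mulnSr.
- by apply: rec_add; [rec_auto|exact: (rec_weak (rec_weak rf))].
Qed.
#[local] Hint Resolve rec_add rec_pred rec_sub rec_mul : rec.

Lemma rec_exp k (f g : ctx k -> nat) : rec f -> rec g -> rec (fun x => f x ^ g x)%N.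
Proof.
move=> rf rg; have := @rec_prim k (fun _ => 1%N) g (fun x _ a => a * f x)%N _ _ rg.
move=> H; apply: rec_ext (H _ _); try by rec_auto.
- by move=> x; elim: (g x) => [|n /= ->]; rewrite ?expn0 // expnSr.
- by apply: rec_mul; [rec_auto|exact: (rec_weak (rec_weak rf))].
Qed.
#[local] Hint Resolve rec_exp : rec.

Definition recb k (P : ctx k -> bool) := rec (fun x => nat_of_bool (P x)).

Lemma recb_ext k (f g : ctx k -> bool) : f =1 g -> recb f -> recb g.
Proof. by move=> fg; apply: rec_ext => x; rewrite fg. Qed.

Lemma recb_cst k (b : bool) : recb (fun _ : ctx k => b).
Proof. exact: rec_cst. Qed.

Lemma recb_leq k (f g : ctx k -> nat) : rec f -> rec g -> recb (fun x => f x <= g x)%N.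
Proof.
move=> rf rg; apply: (@rec_ext _ (fun x => 1 - (f x - g x))%N); last by rec_auto.
by move=> x; case: leqP; lia.
Qed.
#[local] Hint Resolve recb_leq recb_cst : rec.

Lemma recb_and k (f g : ctx k -> bool) : recb f -> recb g -> recb (fun x => f x && g x).
Proof.
rewrite /recb => rf rg; apply: (@rec_ext _ (fun x => (f x : nat) * g x)%N); last by rec_auto.
by move=> x; case: (f x); case: (g x).
Qed.

Lemma recb_neg k (f : ctx k -> bool) : recb f -> recb (fun x => ~~ f x).
Proof.
rewrite /recb => rf; apply: (@rec_ext _ (fun x => 1 - (f x : nat))%N); last by rec_auto.
by move=> x; case: (f x).
Qed.
#[local] Hint Resolve recb_and recb_neg : rec.

Lemma recb_or k (f g : ctx k -> bool) : recb f -> recb g -> recb (fun x => f x || g x).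
Proof.
move=> rf rg; apply: (@recb_ext _ (fun x => ~~ (~~ f x && ~~ g x))); last by rec_auto.
by move=> x; case: (f x); case: (g x).
Qed.

Lemma recb_imp k (f g : ctx k -> bool) : recb f -> recb g -> recb (fun x => f x ==> g x).
Proof.
move=> rf rg; apply: (@recb_ext _ (fun x => ~~ (f x && ~~ g x))); last by rec_auto.
by move=> x; case: (f x); case: (g x).
Qed.

Lemma recb_eq k (f g : ctx k -> nat) : rec f -> rec g -> recb (fun x => f x == g x).
Proof.
move=> rf rg; apply: (@recb_ext _ (fun x => (f x <= g x) && (g x <= f x))%N);
  last by rec_auto.
by move=> x; rewrite eqn_leq.
Qed.
#[local] Hint Resolve recb_or recb_imp recb_eq : rec.

Lemma rec_if k (b : ctx k -> bool) (f g : ctx k -> nat) : recb b -> rec f -> rec g ->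
  rec (fun x => if b x then f x else g x).
Proof.
rewrite /recb => rb rf rg.
apply: (@rec_ext _ (fun x => (b x : nat) * f x + (1 - (b x : nat)) * g x)%N);
  last by rec_auto.
by move=> x; case: (b x) => /=; lia.
Qed.

Lemma recb_all k (B : ctx k -> nat) (P : ctx k -> nat -> bool) :
  rec B -> recb (fun y : ctx k.+1 => P y.1 y.2) ->
  recb (fun x => all (P x) (iota 0 (B x))).
Proof.
move=> rB rP.
have := @rec_prim k (fun _ => 1%N) B (fun x m a => a * (P x m : nat))%N _ _ rB.
move=> H; apply: rec_ext (H _ _); try by rec_auto.
  move=> x; elim: (B x) => [|n IH] //.
  have -> : iota 0 n.+1 = rcons (iota 0 n) n by rewrite -addn1 iotaD cats1.
  by rewrite all_rcons andbC -mulnb -IH.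
by apply: rec_mul; [rec_auto|exact: (rec_skip rP)].
Qed.

Lemma recb_has k (B : ctx k -> nat) (P : ctx k -> nat -> bool) :
  rec B -> recb (fun y : ctx k.+1 => P y.1 y.2) ->
  recb (fun x => has (P x) (iota 0 (B x))).
Proof.
move=> rB rP.
apply: (@recb_ext _ (fun x => ~~ all (fun m => ~~ P x m) (iota 0 (B x)))).
  by move=> x; rewrite -has_predC; apply: eq_has => m /=; rewrite negbK.
by apply: recb_neg; apply: recb_all => //; rec_auto.
Qed.

Lemma rec_mu k (P : ctx k -> nat -> bool) (g : ctx k -> nat) :
  recb (fun y : ctx k.+1 => P y.1 y.2) ->
  (forall x, P x (g x) /\ forall m, (m < g x)%N -> ~~ P x m) -> rec g.
Proof.
move=> rP gP; have rN : rec (fun y : ctx k.+1 => nat_of_bool (~~ P y.1 y.2)).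
  exact: (recb_neg rP).
apply: (recursive_mu rN) => x; have [Pg gmin] := gP (env x); split.
  by rewrite env_cons Pg.
by move=> m /gmin; rewrite env_cons => /negPf /= ->.
Qed.

Lemma rec_find k (B : ctx k -> nat) (P : ctx k -> nat -> bool) :
  rec B -> recb (fun y : ctx k.+1 => P y.1 y.2) ->
  rec (fun x => find (P x) (iota 0 (B x))).
Proof.
(* [find] returns [B x] when nothing is found; the disjunct [B x <= m] makes the unbounded search
   stop there. *)
move=> rB rP; apply: (@rec_mu _ (fun x m => P x m || (B x <= m)%N)).
  apply: recb_or => //; apply: recb_leq; last by rec_auto.
  exact: (rec_weak rB).
move=> x; split.
  have [h|/hasNfind ->] := boolP (has (P x) (iota 0 (B x))).
    have hs := h; rewrite has_find size_iota in hs.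
    by have := nth_find 0%N h; rewrite nth_iota // add0n => ->.
  by rewrite size_iota leqnn orbT.
move=> m mf; have := before_find 0%N mf.
have mB : (m < B x)%N.
  by apply: leq_trans mf _; have := find_size (P x) (iota 0 (B x)); rewrite size_iota.
by rewrite nth_iota // add0n => ->; rewrite -ltnNge.
Qed.
#[local] Hint Resolve rec_if recb_all recb_has rec_find : rec.

(** * Sequence numbers *)

Lemma nth_prime_prime i : prime (nth_prime i).
Proof. by case: i => [//|i] /=; case: ex_minnP => p /andP[]. Qed.

Lemma nth_prime_ltS i : (nth_prime i < nth_prime i.+1)%N.
Proof. by rewrite /=; case: ex_minnP => p /andP[]. Qed.

Lemma nth_prime_lt i j : (i < j)%N -> (nth_prime i < nth_prime j)%N.
Proof. exact: (homo_ltn ltn_trans nth_prime_ltS). Qed.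

Lemma nth_prime_eq i j : (nth_prime i == nth_prime j) = (i == j).
Proof.
by case: (ltngtP i j) => [/nth_prime_lt|/nth_prime_lt|->]; rewrite ?eqxx //; lia.
Qed.

Lemma seqcode_rcons u k :
  seqcode (rcons u k) = (seqcode u * nth_prime (size u) ^ k.+1)%N.
Proof.
rewrite /seqcode size_rcons big_ord_recr /= nth_rcons ltnn eqxx; congr (_ * _)%N.
by apply: eq_bigr => i _; rewrite nth_rcons ltn_ord.
Qed.

Lemma seqcode_nil : seqcode [::] = 1%N.
Proof. by rewrite /seqcode big_ord0. Qed.

Lemma seqcode_gt0 u : (0 < seqcode u)%N.
Proof.
by apply: prodn_gt0 => i; rewrite expn_gt0 prime_gt0 // nth_prime_prime.
Qed.

(** The exponent [u_i + 1] is positive exactly below the length, so the exponents recover both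
    length and entries. *)
Lemma logn_seqcode u i :
  logn (nth_prime i) (seqcode u) = if (i < size u)%N then (nth 0 u i).+1 else 0%N.
Proof.
elim/last_ind: u => [|u k IH]; first by rewrite seqcode_nil logn1.
rewrite seqcode_rcons lognM ?seqcode_gt0 ?expn_gt0 ?prime_gt0 ?nth_prime_prime //.
rewrite IH lognX logn_prime ?nth_prime_prime // size_rcons nth_rcons ltnS nth_prime_eq.
by case: ltngtP => //=; rewrite ?muln0 ?muln1 ?addn0.
Qed.

Lemma seqcode_inj : injective seqcode.
Proof.
move=> u v e.
have h i : (if (i < size u)%N then (nth 0 u i).+1 else 0%N) =
           (if (i < size v)%N then (nth 0 v i).+1 else 0%N).
  by rewrite -!logn_seqcode e.
apply: (@eq_from_nth _ 0%N).
  have := h (size u); have := h (size v); rewrite !ltnn.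
  by case: ltngtP.
by move=> i iu; have := h i; rewrite iu; case: ifP => // _ [].
Qed.

Lemma seqcodeK u : seqdecode (seqcode u) = u.
Proof.
rewrite /seqdecode; case: xgetP => [v _ /= /seqcode_inj//|/(_ u) /= /(_ erefl)//].
Qed.

Lemma proj_seqcode u i : proj (seqcode u) i = nth 0%N u i.
Proof. by rewrite /proj seqcodeK. Qed.

Lemma seqdecodeP s : seqdecode s = [::] \/ seqcode (seqdecode s) = s.
Proof.
by rewrite /seqdecode; case: xgetP => [v _ /= ?|_]; [right|left].
Qed.

Lemma nth_lt_seqcode u i : (nth 0 u i < seqcode u)%N.
Proof.
have [iu|ui] := ltnP i (size u); last by rewrite nth_default // seqcode_gt0.
apply: leq_trans (dvdn_leq (seqcode_gt0 u) (pfactor_dvdnn (nth_prime i) _)).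
rewrite logn_seqcode iu.
by apply: leq_trans (ltn_expl _ (prime_gt1 (nth_prime_prime i))).
Qed.

Lemma size_lt_seqcode u : (size u < seqcode u)%N.
Proof.
elim/last_ind: u => [|u k IH]; first by rewrite seqcode_nil.
rewrite seqcode_rcons size_rcons; apply: leq_ltn_trans IH _.
rewrite -[ltnLHS]muln1 ltn_pmul2l ?seqcode_gt0 //.
exact: leq_ltn_trans _ (ltn_expl k.+1 (prime_gt1 (nth_prime_prime _))).
Qed.

Lemma proj_le s i : (proj s i <= s)%N.
Proof.
rewrite /proj; have [->|{2}<-] := seqdecodeP s; first by rewrite nth_nil.
exact/ltnW/nth_lt_seqcode.
Qed.

Lemma proj0n i : proj 0 i = 0%N.
Proof. by apply/eqP; rewrite -leqn0 proj_le. Qed.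

(** Turns a quantifier over the sequences pointwise below [v], of the same length, into a search up
    to the code of [v]. *)
Lemma seqcode_le u v : size u = size v ->
  (forall i, (i < size u)%N -> (nth 0 u i <= nth 0 v i)%N) ->
  (seqcode u <= seqcode v)%N.
Proof.
move=> e h; rewrite /seqcode -e; apply: leq_prod => i _.
by apply: leq_pexp2l; rewrite ?prime_gt0 ?nth_prime_prime // ltnS h.
Qed.

Lemma recb_dvdn k (f g : ctx k -> nat) : rec f -> rec g -> recb (fun x => f x %| g x)%N.
Proof.
move=> rf rg.
apply: (@recb_ext _ (fun x => has (fun m => g x == m * f x)%N (iota 0 (g x).+1))).
  move=> x; apply/hasP/idP => [[m _ /eqP ->]|/dvdnP[m e]]; first exact: dvdn_mull.
  have [g0|g0] := posnP (g x); first by exists 0%N; rewrite ?g0 ?mul0n ?mem_iota.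
  exists m; rewrite e // in g0 *; rewrite mem_iota /= add0n ltnS leq_pmulr //.
  by move: g0; rewrite muln_gt0 => /andP[].
apply: recb_has; first by rec_auto.
by apply: recb_eq; [exact: rec_weak|apply: rec_mul; [rec_auto|exact: rec_weak]].
Qed.
#[local] Hint Resolve recb_dvdn : rec.

Lemma primeE p : prime p = (1 < p)%N &&
  all (fun d => (d %| p)%N ==> ((d == 1%N) || (d == p))) (iota 0 p.+1).
Proof.
apply/idP/andP => [/primeP[p1 h]|[p1 /allP h]].
  by split=> //; apply/allP => d _; apply/implyP => /h.
apply/primeP; split=> // d dp; have := h d; rewrite dp mem_iota add0n ltnS; apply.
exact: dvdn_leq (ltnW p1) dp.
Qed.

Lemma recb_prime k (f : ctx k -> nat) : rec f -> recb (fun x => prime (f x)).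
Proof.
move=> rf; apply: (@recb_ext _ (fun x => (1 < f x)%N &&
  all (fun d => (d %| f x)%N ==> ((d == 1%N) || (d == f x))) (iota 0 (f x).+1))).
  by move=> x; rewrite -primeE.
have := rec_weak rf; rec_auto.
Qed.
#[local] Hint Resolve recb_prime : rec.

Lemma rec_nth_prime k (f : ctx k -> nat) : rec f -> rec (fun x => nth_prime (f x)).
Proof.
apply: rec_comp1.
pose G m := ex_minn (ex_prime_above m).
have rG : rec1 G.
  apply: (@rec_mu _ (fun (x : ctx 1) p => (x.2 < p)%N && prime p)); first by rec_auto.
  move=> x; rewrite /G; case: ex_minnP => p h hmin; split=> // m mp.
  by apply/negP => /hmin; rewrite leqNgt mp.
have := @rec_prim 1 (fun=> 2%N) (fun x => x.2) (fun _ _ a => G a) _ _ _.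
move=> H; apply: rec_ext (H _ _ _).
- by move=> [x n] /=; elim: n => //= n ->.
- by rec_auto.
- exact: (rec_comp1 rG (rec_var1 _)).
- by rec_auto.
Qed.
#[local] Hint Resolve rec_nth_prime : rec.

Definition primelog i s := find (fun e => ~~ (nth_prime i ^ e.+1 %| s))%N (iota 0 s).

Lemma primelogE i s : primelog i s = logn (nth_prime i) s.
Proof.
rewrite /primelog; have [->|s0] := posnP s; first by rewrite logn0.
under eq_find do rewrite pfactor_dvdn ?nth_prime_prime // -ltnNge ltnS.
have L : (logn (nth_prime i) s < s)%N.
  by apply: ltn_logl s0.
set l := logn _ _ in L *; have := find_size (fun x => l <= x)%N (iota 0 s).
rewrite size_iota => fs.
case: (ltngtP (find (fun x => l <= x)%N (iota 0 s)) l) => // h.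
  have := @nth_find _ 0%N (fun x => l <= x)%N (iota 0 s).
  rewrite has_find size_iota nth_iota; last by apply: ltn_trans L.
  by move=> /(_ (ltn_trans h L)); rewrite add0n leqNgt h.
have := @before_find _ 0%N (fun x => l <= x)%N (iota 0 s) l h.
by rewrite nth_iota // add0n leqnn.
Qed.

Lemma rec_primelog k (f g : ctx k -> nat) : rec f -> rec g ->
  rec (fun x => primelog (f x) (g x)).
Proof.
move=> rf rg; have := rec_weak rf; have := rec_weak rg; rewrite /primelog.
by rec_auto.
Qed.
#[local] Hint Resolve rec_primelog : rec.

Definition prime_part s n :=
  nat_rec (fun _ => nat) 1%N (fun i a => a * nth_prime i ^ primelog i s)%N n.

Lemma prime_partE s n : prime_part s n = (\prod_(i < n) nth_prime i ^ logn (nth_prime i) s)%N.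
Proof.
elim: n => [|n IH]; first by rewrite big_ord0.
by rewrite big_ord_recr /= -IH -primelogE.
Qed.

Lemma rec_prime_part k (f g : ctx k -> nat) : rec f -> rec g ->
  rec (fun x => prime_part (f x) (g x)).
Proof.
move=> rf rg; apply: (@rec_prim _ _ _ (fun x i a => a * nth_prime i ^ primelog i (f x))%N) => //;
  first by rec_auto.
have := rec_weak (rec_weak rf); rec_auto.
Qed.
#[local] Hint Resolve rec_prime_part : rec.

Definition is_code s :=
  has (fun n => all (fun i => 0 < primelog i s)%N (iota 0 n) && (prime_part s n == s))
      (iota 0 s.+1).

Lemma is_codeP s : reflect (exists u, seqcode u = s) (is_code s).
Proof.
apply: (iffP hasP) => [[n _ /andP[/allP h /eqP e]]|[u <-]].
  exists (mkseq (fun i => (logn (nth_prime i) s).-1) n).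
  rewrite -[RHS]e prime_partE /seqcode size_mkseq; apply: eq_bigr => i _.
  rewrite nth_mkseq // prednK // -primelogE h // mem_iota /=; exact: ltn_ord.
exists (size u); first by rewrite mem_iota /= add0n ltnS ltnW // size_lt_seqcode.
apply/andP; split.
  apply/allP => i; rewrite mem_iota /= add0n => iu.
  by rewrite primelogE logn_seqcode iu.
rewrite prime_partE; apply/eqP; apply: eq_bigr => i _.
by rewrite logn_seqcode ltn_ord.
Qed.

Lemma recb_is_code k (f : ctx k -> nat) : rec f -> recb (fun x => is_code (f x)).
Proof.
move=> rf; have r1 := rec_weak rf; have r2 := rec_weak r1.
by rewrite /is_code; rec_auto.
Qed.
#[local] Hint Resolve recb_is_code : rec.

(** [proj] is defined by choosing a decoding; this arithmetical form in terms of prime exponents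
    shows that it is recursive. *)
Lemma projE s i : proj s i = if is_code s then (primelog i s).-1 else 0%N.
Proof.
rewrite /proj; case: is_codeP => [[u <-]|h].
  rewrite seqcodeK primelogE logn_seqcode; case: ltnP => // ui.
  by rewrite nth_default.
have [->|e] := seqdecodeP s; first by rewrite nth_nil.
by case: h; exists (seqdecode s).
Qed.

Lemma rec_proj k (f g : ctx k -> nat) : rec f -> rec g ->
  rec (fun x => proj (f x) (g x)).
Proof.
move=> rf rg; apply: (@rec_ext _ (fun x =>
  if is_code (f x) then (primelog (g x) (f x)).-1 else 0%N)).
  by move=> x; rewrite projE.
by rec_auto.
Qed.

Lemma rec_seqcode1 k (f : ctx k -> nat) : rec f -> rec (fun x => seqcode [:: f x]).
Proof.
move=> rf; apply: (@rec_ext _ (fun x => 1 * nth_prime 0 ^ (f x).+1)%N).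
  by move=> x; rewrite -seqcode_nil -(seqcode_rcons [::]).
by rec_auto.
Qed.

Lemma rec_seqcode2 k (f g : ctx k -> nat) : rec f -> rec g ->
  rec (fun x => seqcode [:: f x; g x]).
Proof.
move=> rf rg; apply: (@rec_ext _ (fun x => seqcode [:: f x] * nth_prime 1 ^ (g x).+1)%N).
  by move=> x; rewrite -(seqcode_rcons [:: _]).
by have := rec_seqcode1 rf; rec_auto.
Qed.

Lemma rec_seqcode3 k (f g h : ctx k -> nat) : rec f -> rec g -> rec h ->
  rec (fun x => seqcode [:: f x; g x; h x]).
Proof.
move=> rf rg rh; apply: (@rec_ext _ (fun x => seqcode [:: f x; g x] * nth_prime 2 ^ (h x).+1)%N).
  by move=> x; rewrite -(seqcode_rcons [:: _; _]).
by have := rec_seqcode2 rf rg; rec_auto.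
Qed.
#[local] Hint Resolve rec_proj rec_seqcode1 rec_seqcode2 rec_seqcode3 : rec.

(** * Recursive rational-valued functions *)

Section RationalFunctions.
Variable R : realType.
Implicit Types k : nat.

(* The comparison of two rational-valued functions of this form is a comparison
   of natural numbers. *)
Definition recR k (f : ctx k -> R) := exists p n d : ctx k -> nat,
  [/\ rec p, rec n, rec d & forall x, f x = ((p x)%:R - (n x)%:R) / (d x).+1%:R].

Lemma recR_ext k (f g : ctx k -> R) : f =1 g -> recR f -> recR g.
Proof.
by move=> fg [p [n [d [rp rn rd e]]]]; exists p, n, d; split=> // x; rewrite -fg.
Qed.

Lemma recR_nat k (f : ctx k -> nat) : rec f -> recR (fun x => (f x)%:R).
Proof.
move=> rf; exists f, (fun=> 0%N), (fun=> 0%N); split; try by rec_auto.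
by move=> x; rewrite divr1 subr0.
Qed.

Lemma recR_0 k : recR (fun _ : ctx k => 0).
Proof. exact: (@recR_nat _ (fun=> 0%N) (rec_cst _ _)). Qed.

Lemma recR_1 k : recR (fun _ : ctx k => 1).
Proof. exact: (@recR_nat _ (fun=> 1%N) (rec_cst _ _)). Qed.

Lemma recR_opp k (f : ctx k -> R) : recR f -> recR (fun x => - f x).
Proof.
move=> [p [n [d [rp rn rd e]]]]; exists n, p, d; split => // x.
by rewrite e -mulNr opprB.
Qed.

Lemma recR_mul k (f g : ctx k -> R) : recR f -> recR g -> recR (fun x => f x * g x).
Proof.
move=> [p [n [d [rp rn rd e]]]] [p' [n' [d' [rp' rn' rd' e']]]].
exists (fun x => p x * p' x + n x * n' x)%N, (fun x => p x * n' x + n x * p' x)%N,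
  (fun x => ((d x).+1 * (d' x).+1).-1)%N; split; try by rec_auto.
move=> x; rewrite e e' mulf_div prednK ?muln_gt0 // natrM; congr (_ / _).
by rewrite !natrD !natrM; ring.
Qed.

Lemma recR_add k (f g : ctx k -> R) : recR f -> recR g -> recR (fun x => f x + g x).
Proof.
move=> [p [n [d [rp rn rd e]]]] [p' [n' [d' [rp' rn' rd' e']]]].
exists (fun x => p x * (d' x).+1 + p' x * (d x).+1)%N,
  (fun x => n x * (d' x).+1 + n' x * (d x).+1)%N,
  (fun x => ((d x).+1 * (d' x).+1).-1)%N; split; try by rec_auto.
move=> x; rewrite e e' addf_div ?pnatr_eq0 // prednK ?muln_gt0 // natrM; congr (_ / _).
by rewrite !natrD !natrM; ring.
Qed.

Lemma recR_invS k (f : ctx k -> nat) : rec f -> recR (fun x => (f x).+1%:R^-1).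
Proof.
move=> rf; exists (fun=> 1%N), (fun=> 0%N), f; split; try by rec_auto.
by move=> x; rewrite subr0 div1r.
Qed.

Lemma recR_if k (b : ctx k -> bool) (f g : ctx k -> R) : recb b -> recR f -> recR g ->
  recR (fun x => if b x then f x else g x).
Proof.
move=> rb [p [n [d [rp rn rd e]]]] [p' [n' [d' [rp' rn' rd' e']]]].
exists (fun x => if b x then p x else p' x), (fun x => if b x then n x else n' x),
  (fun x => if b x then d x else d' x); split; try by rec_auto.
by move=> x; case: (b x).
Qed.

Lemma recR_norm k (f : ctx k -> R) : recR f -> recR (fun x => `|f x|).
Proof.
move=> [p [n [d [rp rn rd e]]]].
exists (fun x => p x - n x + (n x - p x))%N, (fun=> 0%N), d; split; try by rec_auto.
move=> x; rewrite e normf_div [`|_.+1%:R|]ger0_norm // subr0; congr (_ / _).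
have [np|pn] := leqP (n x) (p x).
  by rewrite -natrB // normr_nat; congr (_%:R); lia.
by rewrite distrC -natrB 1?ltnW // normr_nat; congr (_%:R); lia.
Qed.

Lemma recb_ler k (f g : ctx k -> R) : recR f -> recR g -> recb (fun x => f x <= g x).
Proof.
move=> [p [n [d [rp rn rd e]]]] [p' [n' [d' [rp' rn' rd' e']]]].
apply: (@recb_ext _ (fun x => p x * (d' x).+1 + n' x * (d x).+1 <=
   p' x * (d x).+1 + n x * (d' x).+1)%N); last by rec_auto.
move=> x; rewrite e e' ler_pdivrMr ?ltr0Sn // mulrAC ler_pdivlMr ?ltr0Sn //.
rewrite !mulrBl lerBlDr addrAC lerBrDr -!natrM -!natrD ler_nat.
by rewrite [RHS]leq_eqVlt leq_eqVlt.
Qed.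

Lemma recb_ltr k (f g : ctx k -> R) : recR f -> recR g -> recb (fun x => f x < g x).
Proof.
move=> rf rg; apply: (@recb_ext _ (fun x => ~~ (g x <= f x))).
  by move=> x; rewrite -ltNge.
by apply: recb_neg; exact: recb_ler.
Qed.

Lemma recR_sum k n (F : 'I_n -> ctx k -> R) : (forall i, recR (F i)) ->
  recR (fun x => \sum_(i < n) F i x).
Proof.
elim: n F => [|n IH] F rF.
  apply: (@recR_ext _ (fun=> 0%:R)); last by apply: recR_nat; rec_auto.
  by move=> x; rewrite big_ord0.
apply: (@recR_ext _ (fun x => F ord0 x + \sum_(i < n) F (lift ord0 i) x)).
  by move=> x; rewrite big_ord_recl.
by apply: recR_add => //; apply: IH.
Qed.

Lemma recb_forall k n (F : 'I_n -> ctx k -> bool) : (forall i, recb (F i)) ->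
  recb (fun x => [forall i, F i x]).
Proof.
elim: n F => [|n IH] F rF.
  apply: (@recb_ext _ (fun=> true)); last by rec_auto.
  by move=> x; apply/esym/forallP => -[].
apply: (@recb_ext _ (fun x => F ord0 x && [forall i, F (lift ord0 i) x])).
  move=> x; apply/andP/forallP => [[h0 /forallP h] i|h].
    by have [j ->|->] := unliftP ord0 i.
  by split=> //; apply/forallP.
by apply: recb_and => //; apply: IH.
Qed.

Lemma recb_exists k n (F : 'I_n -> ctx k -> bool) : (forall i, recb (F i)) ->
  recb (fun x => [exists i, F i x]).
Proof.
move=> rF; apply: (@recb_ext _ (fun x => ~~ [forall i, ~~ F i x])).
  by move=> x; rewrite negb_forall; apply: eq_existsb => i; rewrite negbK.
by apply/recb_neg/recb_forall => i; exact: recb_neg.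
Qed.

End RationalFunctions.
#[local] Hint Resolve recb_forall recb_exists : rec.
(* Syntactic matching on the goal: the canonical structures in the instances of the
   ring and order operations depend on how the term was elaborated. *)
#[local] Hint Extern 1 (recR _) => (lazymatch goal with
  | |- recR (fun x => @GRing.zero _) => apply: recR_0
  | |- recR (fun x => @GRing.one _) => apply: recR_1
  | |- recR (fun x => @GRing.natmul _ _ _) => apply: recR_nat
  | |- recR (fun x => @GRing.inv _ _) => apply: recR_invS
  | |- recR (fun x => @GRing.opp _ _) => apply: recR_opp
  | |- recR (fun x => @GRing.add _ _ _) => apply: recR_add
  | |- recR (fun x => @GRing.mul _ _ _) => apply: recR_mul
  | |- recR (fun x => @Num.norm _ _ _) => apply: recR_norm
  | |- recR (fun x => if _ then _ else _) => apply: recR_if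
  | |- recR (fun x => @bigop.body _ _ _ _ _) => apply: recR_sum
  end) : rec.
#[local] Hint Extern 1 (recb _) => (lazymatch goal with
  | |- recb (fun x => @Order.le _ _ _ _) => apply: recb_ler
  | |- recb (fun x => @Order.lt _ _ _ _) => apply: recb_ltr
  end) : rec.

(** * Rational radii and centers *)

Section Numbers.
Variable R : realType.

Lemma recR_q k (f : ctx k -> nat) : rec f -> recR (fun x => q (f x) : R).
Proof. by move=> rf; rewrite /q; rec_auto. Qed.

Lemma recR_real_center k (f : ctx k -> nat) : rec f -> recR (fun x => real_center (f x) : R).
Proof.
move=> rf; rewrite /real_center.
apply: (@recR_ext _ _ (fun x => (if has (fun m => proj (f x) 0 == m * 2)%N (iota 0 (f x).+1)
  then 1%:R else - 1%:R) * (proj (f x) 1)%:R * (proj (f x) 2).+1%:R^-1)).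
  move=> x; congr (_ * _ * _); rewrite -signr_odd.
  have -> : has (fun m => proj (f x) 0 == m * 2)%N (iota 0 (f x).+1) = ~~ odd (proj (f x) 0).
    apply/hasP/idP => [[m _ /eqP ->]|]; first by rewrite oddM andbF.
    rewrite -dvdn2 => /dvdnP[m e]; exists m; last by rewrite e.
    by rewrite mem_iota add0n ltnS; apply: leq_trans (proj_le (f x) 0); rewrite e; lia.
  by case: (odd _).
by have := rec_weak rf; rec_auto.
Qed.

(** Round [|x|] down to a multiple of some [1/(d+1) <= e]; the first entry of the code carries the
    sign. *)
Lemma rational_code (e : R) : 0 < e -> forall x, exists s, `|real_center s - x| <= e.
Proof.
move=> e0 x.
have [d de] : exists d : nat, d.+1%:R^-1 <= e.
  by have [d] := ltr_add_invr e0; rewrite add0r => /ltW; exists d.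
have h y : 0 <= y -> exists p : nat, `|p%:R / d.+1%:R - y| <= e.
  move=> y0; have yd0 : 0 <= y * d.+1%:R by rewrite mulr_ge0.
  exists (Num.truncn (y * d.+1%:R)); apply: le_trans de.
  rewrite -[X in _ - X](@mulfK _ d.+1%:R) ?pnatr_eq0 // -mulrBl normrM.
  rewrite [`|_^-1|]ger0_norm // ler_piMl // distrC.
  have /andP[h1 h2] := truncn_itv yd0.
  rewrite ger0_norm ?subr_ge0 // lerBlDl; apply: ltW.
  by rewrite natr1.
have [x0|x0] := leP 0 x.
  have [p hp] := h x x0; exists (seqcode [:: 0; p; d]).
  by rewrite /real_center !proj_seqcode /= expr0 mul1r.
have [p hp] := h (- x) ltac:(lra); exists (seqcode [:: 1; p; d]).
rewrite /real_center !proj_seqcode /= expr1 mulN1r mulNr -normrN opprB addrC.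
by rewrite opprK; rewrite opprK in hp.
Qed.

Lemma real_center_le s : `|real_center s| <= s%:R :> R.
Proof.
rewrite /real_center !normrM normrX normrN1 expr1n mul1r normr_nat.
rewrite ger0_norm // ler_pdivrMr ?ltr0Sn //.
apply: le_trans (_ : s%:R <= _); first by rewrite ler_nat proj_le.
by rewrite ler_peMr // ler1n.
Qed.

Lemma radius_code d : q (seqcode [:: 1%N; d]) = d.+1%:R^-1 :> R.
Proof. by rewrite /q !proj_seqcode /= div1r. Qed.

End Numbers.
#[local] Hint Resolve recR_q recR_real_center : rec.

(** * Codes of trees *)

Definition rec3 (f : nat -> nat -> nat -> nat) :=
  rec (fun x : ctx 3 => f x.1.1.2 x.1.2 x.2).
Definition rec4 (f : nat -> nat -> nat -> nat -> nat) :=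
  rec (fun x : ctx 4 => f x.1.1.1.2 x.1.1.2 x.1.2 x.2).

Lemma rec_comp3 f k (g h i : ctx k -> nat) : rec3 f -> rec g -> rec h -> rec i ->
  rec (fun x => f (g x) (h x) (i x)).
Proof.
move=> rf rg rh ri.
apply: (@recursive_tuple 3 k _ (fun t => [tuple i (env t); h (env t); g (env t)]) rf).
by move=> [[|[|[|//]]] hi].
Qed.

Lemma rec_comp4 f k (g h i j : ctx k -> nat) :
  rec4 f -> rec g -> rec h -> rec i -> rec j ->
  rec (fun x => f (g x) (h x) (i x) (j x)).
Proof.
move=> rf rg rh ri rj.
apply: (@recursive_tuple 4 k _
  (fun t => [tuple j (env t); i (env t); h (env t); g (env t)]) rf).
by move=> [[|[|[|[|//]]]] hi].
Qed.

Section BaireBalls.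
Variable R : realType.

(** A difference at [m] violates a positive radius [p/(d+1)] only if [1/(m+1) >= p/(d+1)], hence
    [m <= d]: finitely many values of [y] decide membership. *)
Definition baire_ball (s : nat) (y : baire) : bool :=
  ((0 : R) < q (proj s 1)) &&
  all (fun m => (y m != proj (proj s 0) m) ==> (m.+1%:R^-1 < (q (proj s 1) : R)))
      (iota 0 (proj (proj s 1) 1).+2).

(** The distance is the largest of the numbers [1/(m+1)] over all places [m] of difference, or 0 if
    there are none. *)
Lemma baire_dist_lt (a b : baire) (r : R) :
  baire_dist a b < r <-> 0 < r /\ forall m, a m != b m -> m.+1%:R^-1 < r.
Proof.
rewrite /baire_dist; case: pselect => [h|h].
  case: ex_minnP => n an nmin; split=> [nr|[r0]]; last exact.
  split=> [|m /nmin nm]; first by apply: le_lt_trans nr; rewrite invr_ge0.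
  by apply: le_lt_trans nr; rewrite lef_pV2 ?posrE // ler_nat.
by split=> [r0|[]//]; split=> // m am; case: h; exists m.
Qed.

Lemma baire_ballP s (y : baire) : nball (BaireSpace R) s y <-> baire_ball s y.
Proof.
rewrite /nball /= baire_dist_lt /baire_ball; split.
  move=> [-> h]; apply/allP => m _; apply/implyP => ym.
  by apply: h; rewrite eq_sym.
move=> /andP[q0 /allP h]; split=> // m ym.
have [mK|mK] := leqP (proj (proj s 1) 1).+2 m.
  have p1 : (0 < proj (proj s 1) 0)%N.
    by move: q0; rewrite /q; case: (proj _ 0) => //; rewrite mul0r ltxx.
  rewrite /q; apply: (@lt_le_trans _ _ (1 / (proj (proj s 1) 1).+1%:R)).
    by rewrite div1r ltf_pV2 ?posrE // ltr_nat; lia.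
  by rewrite ler_pM2r ?invr_gt0 // ler1n.
have := h m; rewrite mem_iota /= add0n => /(_ mK) /implyP; apply.
by rewrite eq_sym.
Qed.

Lemma rec_baire_ball k (f : ctx k -> nat) (y : ctx k -> baire) :
  rec f -> rec (fun x : ctx k.+1 => y x.1 x.2) ->
  recb (fun x => baire_ball (f x) (y x)).
Proof.
by move=> rf ry; have := rec_weak rf; rewrite /baire_ball; rec_auto.
Qed.

Lemma baire_ball_ext s (y z : baire) :
  (forall m, (m <= s.+1)%N -> y m = z m) -> baire_ball s y = baire_ball s z.
Proof.
move=> yz; rewrite /baire_ball; congr (_ && _); apply: eq_in_all => m.
rewrite mem_iota add0n => /andP[_ hm]; rewrite yz //.
have := proj_le s 1; have := proj_le (proj s 1) 1; lia.
Qed.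

(** Supplies the uniqueness in [pval]: the ball of radius [1/(n+1)] around the prefix of length
    [n+1] fixes the value at [n]. *)
Lemma baire_ball_eq (y z : baire) :
  (forall s, nball (BaireSpace R) s y <-> nball (BaireSpace R) s z) -> y = z.
Proof.
move=> yz; apply: funext => n.
pose s := seqcode [:: seqcode (mkseq y n.+1); seqcode [:: 1%N; n]].
have [h _] := yz s; move: h; rewrite /nball /= !baire_dist_lt.
rewrite [proj s 1]proj_seqcode [proj s 0]proj_seqcode /= radius_code => -[|_ h].
  split=> // m; rewrite proj_seqcode; have [mn|mn] := ltnP m n.+1.
    by rewrite nth_mkseq // eqxx.
  by move=> _; rewrite ltf_pV2 ?posrE // ltr_nat; lia.
apply/eqP; apply: contraT => ne.
have := h n; rewrite proj_seqcode nth_mkseq // => /(_ ne).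
by rewrite ltxx.
Qed.

End BaireBalls.

Section TreeCodes.
Variable R : realType.
Variables (lab : nat -> nat) (child : nat -> nat -> nat) (dat : nat -> nat -> nat).

(* A member [seqcode [:: u; t]] of the course of values is the value at [t] of the
   code of the node [u].  At an inner node, [t = t' + 1] lists the ball [s] at
   argument [n], where [t' = <n, s, ...>], as soon as the values that decide whether
   [s] contains the code of the [n]-th child precede [x]; padding [t'] by a large
   third entry makes this happen. *)
Definition tc_step (x h : nat) : nat :=
  if proj x 1 == 0%N then lab (proj x 0)
  else if lab (proj x 0) != 1%N then dat (proj x 0) (proj x 1).-1
  else if all (fun m => seqcode [:: child (proj x 0) (proj (proj x 1).-1 0); m] < x)%N
              (iota 0 (proj (proj x 1).-1 1).+2)
          && baire_ball R (proj (proj x 1).-1 1)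
               (fun m => proj h (seqcode [:: child (proj x 0) (proj (proj x 1).-1 0); m]))
  then seqcode [:: seqcode [:: proj (proj x 1).-1 0; proj (proj x 1).-1 1];
                   seqcode [:: 1%N; 0%N]]
  else 0%N.

(** The course of values below [n] as a sequence number; the initial 1 codes the empty sequence. *)
Definition tc_hist (n : nat) : nat :=
  nat_rec (fun _ => nat) 1%N (fun x h => h * nth_prime x ^ (tc_step x h).+1)%N n.

Definition tc (x : nat) : nat := proj (tc_hist x.+1) x.

Lemma tc_histE n : exists2 u, size u = n & tc_hist n = seqcode u.
Proof.
elim: n => [|n [u su IH]]; first by exists [::]; rewrite ?seqcode_nil.
exists (rcons u (tc_step n (tc_hist n))); first by rewrite size_rcons su.
by rewrite seqcode_rcons /= IH su.
Qed.

Lemma tc_hist_tc n m : (m < n)%N -> proj (tc_hist n) m = tc m.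
Proof.
elim: n => // n IH; rewrite ltnS leq_eqVlt => /orP[/eqP -> //|mn].
have [u su e] := tc_histE n.
rewrite -IH // /= e -{1}su -seqcode_rcons !proj_seqcode nth_rcons.
by rewrite su mn.
Qed.

Lemma tcE x : tc x = tc_step x (tc_hist x).
Proof.
have [u su e] := tc_histE x.
by rewrite /tc /= e -{1}su -seqcode_rcons proj_seqcode nth_rcons su ltnn eqxx.
Qed.

Definition tcode (u : nat) : baire := fun t => tc (seqcode [:: u; t]).

Lemma tcode0 u : tcode u 0%N = lab u.
Proof. by rewrite /tcode tcE /tc_step !proj_seqcode. Qed.

Lemma tcode_leaf u t : lab u != 1%N -> tcode u t.+1 = dat u t.
Proof. by rewrite /tcode tcE /tc_step !proj_seqcode /= => ->. Qed.

(** The index [0] decodes to radius zero, so it can serve as an entry that lists nothing. *)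
Lemma nball_empty (X : pspace R) (x : X) :
  (0 <= pdist (center X 0%N) x) -> ~ nball X 0%N x.
Proof.
by rewrite /nball /= /q !proj0n mul0r => /le_lt_trans h /h; rewrite ltxx.
Qed.

(** In the discrete metric, open balls of radius 1 are singletons. *)
Lemma nball_omega2 (n s n' s' : nat) :
  nball (pprod (omegaSpace R) (omegaSpace R))
    (seqcode [:: seqcode [:: n; s]; seqcode [:: 1%N; 0%N]]) (n', s') <-> n = n' /\ s = s'.
Proof.
rewrite /nball /= !proj_seqcode /= radius_code /= invr1 gt_max.
split=> [/andP[]|[-> ->]]; last by rewrite !eqxx ltr01.
case: eqP => [->|_]; last by rewrite ltxx.
by move=> _; case: eqP => [->|_]; last by rewrite ltxx.
Qed.

(** The tail of the code of [u] lists exactly the pairs [(n, s)] for which the ball [s] contains the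
    code of the [n]-th child, and these balls determine that code. *)
Lemma tcode_child u n : lab u = 1%N ->
  pval R (shift (tcode u)) n (tcode (child u n)).
Proof.
move=> lu.
have hx s : nball (BaireSpace R) s (tcode (child u n)) <->
    Uset (pprod (omegaSpace R) (omegaSpace R)) (shift (tcode u)) (n, s).
  split=> [/baire_ballP hs|[t _]].
    (* The ball [s] is decided by the child's values at [m <= s+1]; their indices [<child u n, m>]
       are at most the padding entry, hence precede [x]. *)
    exists (seqcode [:: n; s; seqcode [:: child u n; s.+2]]) => //.
    rewrite /shift /tcode tcE /tc_step !proj_seqcode.
    move EI: (iota _ _) => I; rewrite /= lu /=; set x := seqcode [:: u; _].
    have xJ : (seqcode [:: child u n; s.+2] < x)%N.
      apply: leq_trans (nth_lt_seqcode [:: u; _] 1); rewrite /= ltnS.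
      exact/leqW/ltnW/(nth_lt_seqcode [:: n; s; _] 2).
    have hm m : (m <= s.+1)%N -> (seqcode [:: child u n; m] < x)%N.
      move=> ms; apply: leq_ltn_trans xJ; apply: seqcode_le => // -[|[|]] //= _.
      exact: leqW.
    rewrite ifT; first exact/nball_omega2.
    apply/andP; split.
      by apply/allP => m; rewrite -EI mem_iota add0n => /andP[_ ?]; apply: hm.
    rewrite (@baire_ball_ext _ _ _ (tcode (child u n))) // => m /hm.
    exact: tc_hist_tc.
  (* Conversely, an entry is either the empty ball [0] or a pair whose test succeeded on actual
     values of the child's code. *)
  rewrite /shift /tcode tcE /tc_step !proj_seqcode.
  move EI: (iota _ _) => I; rewrite /= lu /=; set x := seqcode [:: u; _].
  case: ifP => [/andP[/allP ht hb]|_]; last first.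
    by move=> h; exfalso; apply: (nball_empty _ h); rewrite /= le_max ler0n.
  move=> /nball_omega2[nE sE]; rewrite nE sE in ht hb.
  apply/baire_ballP; apply: etrans hb; apply: baire_ball_ext => m ms.
  by apply/esym/tc_hist_tc/ht; rewrite -EI mem_iota /= sE.
split=> [//|y hy]; apply: (@baire_ball_eq R) => s.
by rewrite hx hy.
Qed.

End TreeCodes.

(** The value at [x] is computed from numbers up to [x], and the node that such a number refers to
    is no larger than the number. This yields a modulus of continuity for codes. *)
Lemma tc_local (R : realType) lab lab' child dat dat' X :
  (forall u, (u < X)%N -> lab u = lab' u) ->
  (forall u t, (u < X)%N -> dat u t = dat' u t) ->
  forall x, (x < X)%N -> tc R lab child dat x = tc R lab' child dat' x.
Proof.
move=> hl hd; suff H n : (n <= X)%N -> tc_hist R lab child dat n = tc_hist R lab' child dat' n.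
  by move=> x xX; rewrite /tc H.
elim: n => // n IH nX; rewrite /= IH 1?ltnW //; congr (_ * _ ^ _.+1)%N.
have pX : (proj n 0 < X)%N by apply: leq_ltn_trans (proj_le _ _) nX.
by rewrite /tc_step hl // hd.
Qed.

Lemma rec_tc (R : realType) (lab : nat -> nat -> nat -> nat) (child : nat -> nat -> nat)
    (dat : nat -> nat -> nat -> nat -> nat) :
  rec3 lab -> rec2 child -> rec4 dat ->
  rec3 (fun a b x => tc R (lab a b) child (dat a b) x).
Proof.
move=> rl rc rd; have rl' k := fun f g h => @rec_comp3 _ k f g h rl.
have rc' k := fun f g => @rec_comp2 _ k f g rc.
have rd' k := fun f g h i => @rec_comp4 _ k f g h i rd.
apply: rec_proj; last by rec_auto.
have rs : recb (fun x : ctx 5 => baire_ball R (proj (proj x.2 1).-1 1)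
    (fun m => proj x.1.2 (seqcode [:: child (proj x.2 0) (proj (proj x.2 1).-1 0); m]))).
  by apply: rec_baire_ball; auto 100 with rec nocore.
apply: (@rec_prim 3 (fun=> 1%N) (fun x => x.2.+1) (fun z x h =>
  h * nth_prime x ^ (tc_step R (lab z.1.1.2 z.1.2) child (dat z.1.1.2 z.1.2) x h).+1)%N).
- by rec_auto.
- apply: rec_mul; first by rec_auto.
  apply: rec_exp; first by rec_auto.
  apply: rec_S; rewrite /tc_step.
  by auto 100 with rec nocore.
- by rec_auto.
Qed.

(** * Recursive codes are hyperarithmetical *)

Section ClopenRelations.
Variable R : realType.
Let X := pprod (pprod (BaireSpace R) (BaireSpace R)) (omegaSpace R).

(** A relation decided by finitely many values, with recursive modulus [m], has a semirecursive open
    complement: enumerate the neighbourhoods on which [S] fails. *)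
Lemma Sigma11_clopen (S : baire -> baire -> nat -> bool) (m : nat -> nat) :
  rec3 (fun a b s => S (proj a) (proj b) s) -> rec1 m ->
  (forall a b a' b' s, (forall i, (i <= m s)%N -> a i = a' i /\ b i = b' i) ->
     S a b s = S a' b' s) ->
  @Sigma11 R X [set z | S z.1.1 z.1.2 z.2].
Proof.
move=> rS rm Sloc.
(* The number [n] stands for prefixes of [a] and [b], the argument [s], and a prefix of the
   projected variable. The radius [1/(m s + 1)] enforces agreement up to [m s] and, being at most 1,
   equality of the discrete coordinate. *)
pose e n := if S (proj (proj n 0)) (proj (proj n 1)) (proj n 2) then 0%N else
  seqcode [:: seqcode [:: seqcode [:: seqcode [:: proj n 0; proj n 1]; proj n 2]; proj n 3];
              seqcode [:: 1%N; m (proj n 2)]].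
have eE n (z : pprod X (BaireSpace R)) : nball (pprod X (BaireSpace R)) (e n) z <->
  [/\ ~~ S (proj (proj n 0)) (proj (proj n 1)) (proj n 2),
   proj n 2 = z.1.2 & forall i, (i <= m (proj n 2))%N ->
    [/\ proj (proj n 0) i = z.1.1.1 i, proj (proj n 1) i = z.1.1.2 i & proj (proj n 3) i = z.2 i]].
  rewrite /e; case: ifP => hS.
    split=> [h|[]//]; exfalso; apply: (nball_empty _ h).
    by rewrite /= !le_max ler0n orbT.
  rewrite /nball !proj_seqcode /= !proj_seqcode /= !gt_max radius_code.
  set r := _.+1%:R^-1.
  have r0 : 0 < r :> R by rewrite invr_gt0.
  have r1 : r <= 1 :> R by rewrite invf_le1 ?ler1n.
  have hd (a b : baire) : reflect (forall i, (i <= m (proj n 2))%N -> a i = b i)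
      ((baire_dist a b : R) < r).
    apply: (iffP idP) => [/baire_dist_lt[_ h] i im|h].
      apply/eqP; apply: contraLR (im) => /h.
      by rewrite /r ltf_pV2 ?posrE // ltr_nat -ltnNge.
    apply/baire_dist_lt; split=> // i; rewrite /r ltf_pV2 ?posrE // ltr_nat => ab.
    by rewrite ltnS ltnNge; apply: contra ab => /h ->.
  split.
    move=> /andP[/andP[/andP[/hd h1 /hd h2] h3] /hd h4]; split=> //.
      by apply/eqP; apply: contraLR h3 => ->; rewrite -leNgt.
    by move=> i im; split; auto.
  move=> [_ h0 h]; rewrite h0 eqxx r0 andbT; apply/andP; split; last first.
    by apply/hd => i /h[].
  by apply/andP; split; apply/hd => i /h[].
exists e.
  have rS' k := fun f g h => @rec_comp3 _ k f g h rS.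
  have rm' k := fun f => @rec_comp1 _ k f rm.
  have rSb k (f g h : ctx k -> nat) : rec f -> rec g -> rec h ->
    recb (fun x => S (proj (f x)) (proj (g x)) (h x)) by exact: rS'.
  rewrite /recursive_point.
  have : rec1 e by rewrite /e /rec1; auto 100 with rec nocore.
  by [].
apply/seteqP; split=> -[[a b] s] /=.
  move=> Sz; exists (fun=> 0%N) => -[n _ /eE[/= /negP hS ns h]]; apply: hS.
  rewrite (@Sloc _ _ a b) ?ns // => i.
  by rewrite -ns => /h[].
move=> [g hg]; apply: contraT => nS; exfalso; apply: hg.
pose p (c : baire) := seqcode (mkseq c (m s).+1).
have pE (c : baire) i : (i <= m s)%N -> proj (p c) i = c i.
  by move=> im; rewrite proj_seqcode nth_mkseq.
exists (seqcode [:: p a; p b; s; p g]) => //; apply/eE; rewrite !proj_seqcode /=.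
split=> // [|i im]; last by split; exact: pE.
by rewrite (@Sloc _ _ a b) // => i im; split; exact: pE.
Qed.

Lemma Delta11_clopen (S : baire -> baire -> nat -> bool) (m : nat -> nat) :
  rec3 (fun a b s => S (proj a) (proj b) s) -> rec1 m ->
  (forall a b a' b' s, (forall i, (i <= m s)%N -> a i = a' i /\ b i = b' i) ->
     S a b s = S a' b' s) ->
  @Delta11 R X [set z | S z.1.1 z.1.2 z.2].
Proof.
move=> rS rm Sloc; split; first exact: (Sigma11_clopen rS rm).
have -> : ~` [set z : X | S z.1.1 z.1.2 z.2] = [set z : X | ~~ S z.1.1 z.1.2 z.2].
  by apply/seteqP; split=> z /= /negP.
apply: (@Sigma11_clopen (fun a b s => ~~ S a b s) m) => //.
  exact: (@recb_neg 3 (fun x => S (proj x.1.1.2) (proj x.1.2) x.2)).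
by move=> a b a' b' s h; rewrite (Sloc a b a' b').
Qed.

Lemma Delta11_tcode (lab : baire -> baire -> nat -> nat) (child : nat -> nat -> nat)
    (dat : baire -> baire -> nat -> nat -> nat) (root : nat) :
  rec3 (fun a b => lab (proj a) (proj b)) -> rec2 child ->
  rec4 (fun a b => dat (proj a) (proj b)) ->
  (forall a b a' b' u, (forall i, (i <= u)%N -> a i = a' i /\ b i = b' i) ->
     lab a b u = lab a' b' u /\ dat a b u = dat a' b' u) ->
  @Delta11_recursive R (pprod (BaireSpace R) (BaireSpace R)) (BaireSpace R)
    (fun z => tcode R (lab z.1 z.2) child (dat z.1 z.2) root).
Proof.
move=> rl rc rd loc; rewrite /Delta11_recursive.
pose S a b s := baire_ball R s (tcode R (lab a b) child (dat a b) root).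
have -> : [set z : X | nball (BaireSpace R) z.2
    (tcode R (lab z.1.1 z.1.2) child (dat z.1.1 z.1.2) root)] =
    [set z : X | S z.1.1 z.1.2 z.2].
  by apply/seteqP; split=> z /= /baire_ballP.
(* The ball [s] consults the code at [m <= s+1], that is [tc] at [<root, m>]; nodes met there, and
   the values of [a] and [b] they consult, have indices at most [<root, s+2>]. *)
apply: (@Delta11_clopen S (fun s => seqcode [:: root; s.+2])).
- have rt := rec_tc R rl rc rd.
  have rt' k := fun f g h => @rec_comp3 _ k f g h rt.
  rewrite /rec3 /S.
  apply: (@rec_baire_ball _ 3 (fun x => x.2)
    (fun x => tcode R (lab (proj x.1.1.2) (proj x.1.2)) child
       (dat (proj x.1.1.2) (proj x.1.2)) root)); first by rec_auto.
  by rewrite /tcode; apply: rt'; auto 100 with rec nocore.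
- by rewrite /rec1; rec_auto.
- move=> a b a' b' s h; apply: baire_ball_ext => m ms; rewrite /tcode.
  apply: (@tc_local _ _ _ _ _ _ (seqcode [:: root; m]).+1) => // u.
    rewrite ltnS => um; apply: (loc _ _ _ _ _ _).1 => i iu; apply: h.
    apply: leq_trans iu (leq_trans um _).
    by apply: seqcode_le => // -[|[|]] //= _; exact: leqW.
  move=> t; rewrite ltnS => um; congr (_ t).
  apply: (loc _ _ _ _ _ _).2 => i iu; apply: h.
  apply: leq_trans iu (leq_trans um _).
  by apply: seqcode_le => // -[|[|]] //= _; exact: leqW.
Qed.

End ClopenRelations.

(** * Ranks of well-founded trees *)

Section Ranks.
Variables (lab : nat -> nat) (child : nat -> nat -> nat).

Inductive wf_tree : nat -> Prop :=
| wf_leaf u : lab u = 0%N -> wf_tree u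
| wf_node u : lab u = 1%N -> (forall n, wf_tree (child u n)) -> wf_tree u.

(** The ordinal bookkeeping common to [BC_stage] and [CGC_stage], so that one construction of ranks
    serves both codes. *)
Inductive tree_stage (W : rel nat) : nat -> nat -> Prop :=
| tree_stage_zero x u : ord_zero W x -> lab u = 0%N -> tree_stage W x u
| tree_stage_pos x u (y : nat -> nat) :
    ~ ord_zero W x -> lab u = 1%N -> (forall n, ord_lt W (y n) x) ->
    (forall n, tree_stage W (y n) (child u n)) -> tree_stage W x u.

Lemma well_order_anti (W : rel nat) : wochoice.well_order W -> antisymmetric W.
Proof.
move=> wo x y; apply: (@wochoice.wo_chain_antisymmetric _ W predT) => //.
by move=> A _; exact: wo.
Qed.

(* The ordered sum of the [W n], with a common bottom [0] and a new top [1].  The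
   bottoms of the summands are sent to [0], since a leaf has to have rank zero; ties
   between the numbers without canonical meaning are broken by their size. *)
Definition sum_order (W : nat -> rel nat) (a b : nat) : bool :=
  match a, b with
  | 0, _ => true
  | _, 0 => false
  | _, 1 => true
  | 1, _ => false
  | k.+2, l.+2 => (proj k 0 < proj l 0)%N ||
      (proj k 0 == proj l 0) && (if proj k 1 == proj l 1 then (k <= l)%N
                                 else W (proj k 0) (proj k 1) (proj l 1))
  end.

Lemma sum_order_wo W : (forall n, wochoice.well_order (W n)) ->
  wochoice.well_order (sum_order W).
Proof.
move=> wo; apply: wochoice.antisymmetric_well_order.
  move=> [|[|k]] [|[|l]] //= /andP[].
  case: (ltngtP (proj k 0) (proj l 0)) => //= e.
  case: eqP => [->|ne]; first by rewrite eqxx => kl lk; congr _.+2; lia.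
  case: eqP => [/esym//|_ w1 w2]; case: ne; apply: (well_order_anti (wo (proj k 0))).
  by rewrite w1 e.
move=> A [a aA]; have [A0|A0] := boolP (0%N \in A); first by exists 0%N; split.
have [[k kA]|nA] := pselect (exists k, k.+2 \in A); last first.
  exists 1%N; split; case: a aA => [|[|a]] aA; try by rewrite ?aA // in A0 *.
    by case: nA; exists a.
  1,2: by move=> [|[|b]] // bA; [rewrite bA in A0|case: nA; exists b].
(* The least element is found lexicographically: the least summand met by [A], then the least
   position in its order, then the least number with these two entries. *)
have h0 : exists n, `[< exists2 l, l.+2 \in A & proj l 0 = n >].
  by exists (proj k 0); apply/asboolP; exists k.
case: (ex_minnP h0) => n /asboolP[l1 l1A l1n] nmin.
pose B : {pred nat} := fun x => `[< exists2 l, l.+2 \in A & proj l 0 = n /\ proj l 1 = x >].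
have [|x [[/asboolP[l2 l2A [l2n l2x]] xmin] _]] := wo n B.
  by exists (proj l1 1); apply/asboolP; exists l1.
have h2 : exists l, `[< [/\ l.+2 \in A, proj l 0 = n & proj l 1 = x] >].
  by exists l2; apply/asboolP.
case: (ex_minnP h2) => l /asboolP[lA ln lx] lmin.
exists l.+2; split=> // -[|[|b]] bA //=; first by rewrite bA in A0.
have : (n <= proj b 0)%N by apply: nmin; apply/asboolP; exists b.
rewrite ln; case: ltngtP => //= e _; rewrite lx; case: eqP => xb.
  by apply: lmin; apply/asboolP.
by apply: xmin; apply/asboolP; exists b.
Qed.

Lemma tree_stage_embed (W W' : rel nat) (phi : nat -> nat) :
  (forall x y, ord_lt W x y -> ord_lt W' (phi x) (phi y)) ->
  (forall x, ord_zero W x -> ord_zero W' (phi x)) ->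
  (forall x, ~ ord_zero W x -> ~ ord_zero W' (phi x)) ->
  forall x u, tree_stage W x u -> tree_stage W' (phi x) u.
Proof.
move=> hlt h0 h1 x u; elim=> {x u} [x u x0 lu|x u y x0 lu ylt _ IH].
  by apply: tree_stage_zero; auto.
by apply: (@tree_stage_pos _ _ _ (phi \o y)) => //=; auto.
Qed.

Lemma wf_tree_stage u : wf_tree u ->
  exists W, wochoice.well_order W /\ exists x, tree_stage W x u.
Proof.
elim=> {u} [u lu|u lu _ IH].
  exists leq; split; last by exists 0%N; apply: tree_stage_zero.
  apply: wochoice.antisymmetric_well_order; first exact: anti_leq.
  move=> A [a aA]; have h : exists a, a \in A by exists a.
  by case: (ex_minnP h) => m mA mmin; exists m.
have /choice[Wx hW] : forall n, exists Wx : rel nat * nat,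
    wochoice.well_order Wx.1 /\ tree_stage Wx.1 Wx.2 (child u n).
  by move=> n; have [W [wo [x hx]]] := IH n; exists (W, x).
pose W n := (Wx n).1.
have wo n : wochoice.well_order (W n) by case: (hW n).
(* Bottoms are merged into [0] and every other position goes to its copy in the [n]-th summand; the
   node itself receives the new top [1]. *)
pose phi n x := if `[< ord_zero (W n) x >] then 0%N else (seqcode [:: n; x]).+2.
exists (sum_order W); split; first exact: sum_order_wo.
exists 1%N; apply: (@tree_stage_pos _ _ _ (fun n => phi n (Wx n).2)) => //.
- by move=> /(_ 2%N).
- by move=> n; rewrite /phi /ord_lt; case: ifP.
move=> n; apply: (@tree_stage_embed (W n)); last by case: (hW n).
- move=> x y /andP[xy nxy]; rewrite /phi; case: asboolP => [zx|nx]; case: asboolP => [zy|ny] //.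
  + by move: nxy; rewrite (@well_order_anti _ (wo n) x y) ?eqxx // zx zy.
  + exfalso; apply: nx => z; move: nxy.
    by rewrite (@well_order_anti _ (wo n) x y) ?eqxx // xy zy.
  + rewrite /ord_lt /= !proj_seqcode /= ltnn eqxx (negPf nxy) xy /=.
    by apply: contra nxy => /eqP[/seqcode_inj[->]].
- by move=> x zx y; rewrite /phi asboolT.
- by move=> x zx; rewrite /phi asboolF // => /(_ 0%N).
Qed.

End Ranks.

(** * Convex hulls and separation *)

Section ConvexGeometry.
Variables (R : realType) (N : nat).
Implicit Types (K A : set 'rV[R]_N) (w x y b : 'rV[R]_N).

Lemma convex_setP A : convex_set A <->
  forall x y (t : R), A x -> A y -> 0 <= t -> t <= 1 -> A (t *: x + (1 - t) *: y).
Proof.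
split=> [cA x y t Ax Ay t0 t1|cA x y l].
  by have := cA x y (Itv01 t0 t1); rewrite !inE; apply.
rewrite !inE => Ax Ay; exact: cA.
Qed.

Definition dot w x : R := \sum_i w 0 i * x 0 i.

Lemma dotDr w x y : dot w (x + y) = dot w x + dot w y.
Proof. by rewrite -big_split; apply: eq_bigr => i _; rewrite mxE mulrDr. Qed.

Lemma dotZr w x t : dot w (t *: x) = t * dot w x.
Proof. by rewrite mulr_sumr; apply: eq_bigr => i _; rewrite mxE mulrCA. Qed.

Lemma dotNr w x : dot w (- x) = - dot w x.
Proof. by rewrite -scaleN1r dotZr mulN1r. Qed.

Lemma dotBr w x y : dot w (x - y) = dot w x - dot w y.
Proof. by rewrite dotDr dotNr. Qed.

Lemma dotC w x : dot w x = dot x w.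
Proof. by apply: eq_bigr => i _; rewrite mulrC. Qed.

Lemma coord_le x i : `|x 0 i| <= `|x|.
Proof.
by rewrite [leRHS]/Num.norm /= mx_normrE; apply/bigmax_geP; right => /=; exists (0, i).
Qed.

Lemma norm_le x (r : R) : 0 <= r -> (forall i, `|x 0 i| <= r) -> `|x| <= r.
Proof.
move=> r0 h; rewrite [leLHS]/Num.norm /= mx_normrE; apply/bigmax_leP; split=> // -[i j] _ /=.
by rewrite ord1.
Qed.

(** The dual norm of the maximum norm, hence the Lipschitz constant of [dot w]. *)
Definition norm1 w : R := \sum_i `|w 0 i|.

Lemma norm1_ge0 w : 0 <= norm1 w.
Proof. by apply: sumr_ge0. Qed.

Lemma dot_le w x : `|dot w x| <= norm1 w * `|x|.
Proof.
apply: le_trans (ler_norm_sum _ _ _) _; rewrite mulr_suml; apply: ler_sum => i _.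
by rewrite normrM ler_wpM2l // coord_le.
Qed.

Definition hull m K : set 'rV[R]_N := [set x | exists (l : 'I_m -> R) (p : 'I_m -> 'rV[R]_N),
  [/\ forall i, 0 <= l i, \sum_i l i = 1, forall i, K (p i) & x = \sum_i l i *: p i]].

(** Written as a continuous image of a product of compact sets; iterating it produces the hulls with
    a fixed number of points. *)
Definition join K A : set 'rV[R]_N :=
  (fun z : R^o * ('rV[R]_N * 'rV[R]_N) => z.1 *: z.2.1 + (1 - z.1) *: z.2.2) @`
  (`[0, 1] `*` (K `*` A)).

Lemma compact_join K A : compact K -> compact A -> compact (join K A).
Proof.
move=> cK cA; apply: continuous_compact; last first.
  by apply: compact_setX; [exact: segment_compact|exact: compact_setX].
apply: continuous_subspaceT => z.
have c1 : {for z, continuous (fun z : R^o * ('rV[R]_N * 'rV[R]_N) => z.1)} by exact: cvg_fst.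
have c2 : {for z, continuous (fun z : R^o * ('rV[R]_N * 'rV[R]_N) => z.2.1)}.
  by apply: (@cvg_comp _ _ _ snd fst _ _ _ cvg_snd cvg_fst).
have c3 : {for z, continuous (fun z : R^o * ('rV[R]_N * 'rV[R]_N) => z.2.2)}.
  by apply: (@cvg_comp _ _ _ snd snd _ _ _ cvg_snd cvg_snd).
apply: cvgD; apply: cvgZ => //.
by apply: cvgB => //; exact: cvg_cst.
Qed.

Lemma hull1 K : hull 1 K = K.
Proof.
apply/seteqP; split=> [x [l [p [l0 l1 Kp ->]]]|x Kx].
  by move: l1; rewrite !big_ord1 => ->; rewrite scale1r.
by exists (fun=> 1), (fun=> x); split=> //; rewrite big_ord1 ?scale1r.
Qed.

(** Split off the weight [t] of the first point and renormalize the others by [1 - t]; if [t = 1],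
    the others all vanish. *)
Lemma hull_join m K : hull m.+2 K = join K (hull m.+1 K).
Proof.
apply/seteqP; split=> [x [l [p [l0 l1 Kp ->]]]|
  _ [[t [x y]] /= [t01 [Kx [l [p [l0 l1 Kp ->]]]]]] <-].
  rewrite big_ord_recl in l1; rewrite big_ord_recl.
  pose t := l ord0; have t1 : t <= 1 by rewrite -l1 lerDl sumr_ge0.
  have s1 : \sum_(i < m.+1) l (lift ord0 i) = 1 - t by rewrite -l1 addrC addKr.
  have [te|tn] := eqVneq t 1.
    exists (1, (p ord0, p ord0)) => /=.
      rewrite /= in_itv /= lexx ler01; split=> //; split=> //.
      exists (fun i => (i == ord0)%:R), (fun=> p ord0); split=> //.
        by rewrite (bigD1 ord0) //= big1 ?addr0 // => i /negPf ->.
      by rewrite (bigD1 ord0) //= big1 ?addr0 ?scale1r // => i /negPf ->; rewrite scale0r.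
    rewrite subrr scale0r addr0 big1 => [|i _]; first by rewrite addr0 -te.
    have /eqP : \sum_(i < m.+1) l (lift ord0 i) = 0.
      by rewrite s1 te subrr.
    by rewrite psumr_eq0 // => /allP /(_ i (mem_index_enum _)) /eqP ->; rewrite scale0r.
  have t1' : 0 < 1 - t by rewrite subr_gt0 lt_neqAle tn.
  exists (t, (p ord0, \sum_(i < m.+1) (l (lift ord0 i) / (1 - t)) *: p (lift ord0 i))) => /=.
    rewrite /= in_itv /= t1 l0; split=> //; split=> //.
    exists (fun i => l (lift ord0 i) / (1 - t)), (fun i => p (lift ord0 i)); split=> //.
      by move=> i; rewrite divr_ge0 // ltW.
    by rewrite -mulr_suml s1 divff // gt_eqF.
  congr (_ + _); rewrite scaler_sumr; apply: eq_bigr => i _.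
  by rewrite scalerA mulrCA divff ?mulr1 // gt_eqF.
move: t01; rewrite /= in_itv /= => /andP[t0 t1].
exists (fun i => if unlift ord0 i is Some j then (1 - t) * l j else t),
  (fun i => if unlift ord0 i is Some j then p j else x); split=> [i||i|].
- by case: unlift => // j; rewrite mulr_ge0 // subr_ge0.
- rewrite [LHS]big_ord_recl /= unlift_none; under eq_bigr do rewrite liftK.
  by rewrite -mulr_sumr l1 mulr1 addrC subrK.
- by case: unlift.
- rewrite [RHS]big_ord_recl /= unlift_none; congr (_ + _); rewrite scaler_sumr.
  by apply: eq_bigr => i _; rewrite liftK scalerA.
Qed.

Lemma compact_hull m K : compact K -> compact (hull m.+1 K).
Proof.
move=> cK; elim: m => [|m IH]; first by rewrite hull1.
by rewrite hull_join; exact: compact_join.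
Qed.

Lemma hull_sub m K A : convex_set A -> K `<=` A -> hull m.+1 K `<=` A.
Proof.
move=> /convex_setP cA KA; elim: m => [|m IH]; first by rewrite hull1.
rewrite hull_join => _ [[t [x y]] /= [t01 [Kx hy]] <-].
move: t01; rewrite /= in_itv /= => /andP[t0 t1].
by apply: cA => //; [exact: KA|exact: IH].
Qed.

(* Caratheodory: an affine dependence among more than [N + 1] points allows one of
   them to be removed from a convex combination. *)
Lemma hull_step m K : (N <= m)%N -> hull m.+2 K `<=` hull m.+1 K.
Proof.
move=> Nm x [l [p [l0 l1 Kp ->]]].
(* The rows [(p i, 1)] are [m+2] vectors of length [N+1], hence dependent; the last column says that
   the coefficients sum to zero. *)
pose M := row_mx (\matrix_i p i) (const_mx 1 : 'cV[R]_m.+2).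
have [u [uM u0]] : exists u : 'rV[R]_m.+2, u *m M = 0 /\ u != 0.
  have : kermx M != 0.
    rewrite kermx_eq0 /row_free; apply/negP => /eqP e.
    by have := rank_leq_col M; rewrite e; lia.
  by move=> /rowV0Pn[u /sub_kermxP uM u0]; exists u.
move: uM; rewrite mul_mx_row -row_mx0 => /eq_row_mx[up us].
have sumu : \sum_i u 0 i = 0.
  have := congr1 (fun z : 'M[R]_1 => z 0 0) us; rewrite !mxE; apply: etrans.
  by apply: eq_bigr => i _; rewrite mxE mulr1.
have sump : \sum_i u 0 i *: p i = 0.
  rewrite -[RHS]up mulmx_sum_row; apply: eq_bigr => i _.
  by rewrite rowK.
have [i0 ui0] : exists i, 0 < u 0 i.
  apply: contrapT => /forallNP h; move: u0; apply/negP; rewrite negbK.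
  have hn i : 0 <= - u 0 i by rewrite oppr_ge0 leNgt; apply/negP.
  have /eqP : \sum_i (- u 0 i) = 0 by rewrite sumrN sumu oppr0.
  rewrite psumr_eq0 // => /allP hz; apply/eqP/rowP => i; rewrite mxE.
  by have := hz i (mem_index_enum _); rewrite oppr_eq0 => /eqP.
(* Subtracting [t u] with the least ratio [t = l i / u i] keeps all weights nonnegative and
   annihilates the [i]-th. *)
have [i ui imin] := @arg_minP _ _ _ i0 (fun i => 0 < u 0 i) (fun i => l i / u 0 i) ui0.
pose t := l i / u 0 i; pose l' j := l j - t * u 0 j.
have l'0 j : 0 <= l' j.
  rewrite /l' subr_ge0; have [uj|uj] := ltP 0 (u 0 j).
    by rewrite -ler_pdivlMr //; apply: imin.
  by apply: le_trans (l0 j); rewrite mulr_ge0_le0 // divr_ge0 // ltW.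
have l'i : l' i = 0 by rewrite /l' /t divfK ?subrr // gt_eqF.
exists (fun j => l' (lift i j)), (fun j => p (lift i j)); split=> //.
  have : \sum_j l' j = 1 by rewrite sumrB l1 -mulr_sumr sumu mulr0 subr0.
  by rewrite (bigD1_ord i) //= l'i add0r.
have : \sum_j l' j *: p j = \sum_j l j *: p j.
  under eq_bigr do rewrite scalerBl -scalerA.
  by rewrite sumrB -scaler_sumr sump scaler0 subr0.
by move=> <-; rewrite (bigD1_ord i) //= l'i scale0r add0r.
Qed.

Lemma hull_N m K : (N <= m)%N -> hull m.+1 K `<=` hull N.+1 K.
Proof.
elim: m => [|m IH].
  rewrite leqn0 => /eqP N0.
  by have -> : N.+1 = 1%N by rewrite N0.
rewrite leq_eqVlt => /orP[/eqP <- //|Nm].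
by apply: subset_trans (hull_step _) (IH _).
Qed.

(** A mixture of two combinations uses [2N + 2] points, which Caratheodory reduces to [N + 1]. *)
Lemma hull_convex K : convex_set (hull N.+1 K).
Proof.
apply/convex_setP => x y t [l [p [l0 l1 Kp ->]]] [l' [p' [l'0 l'1 Kp' ->]]] t0 t1.
apply: (@hull_N (N + N.+1)); first by rewrite leq_addr.
exists (fun i => match fintype.split (i : 'I_(N.+1 + N.+1)) with
                 | inl j => t * l j | inr j => (1 - t) * l' j end),
  (fun i => match fintype.split (i : 'I_(N.+1 + N.+1)) with
            | inl j => p j | inr j => p' j end); split=> [i||i|].
- by case: fintype.split => j; rewrite mulr_ge0 // subr_ge0.
- rewrite (@big_split_ord _ _ _ N.+1 N.+1) /=.
  under eq_bigr do rewrite (unsplitK (inl _)).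
  under [X in _ + X]eq_bigr do rewrite (unsplitK (inr _)).
  by rewrite -!mulr_sumr l1 l'1 !mulr1 addrC subrK.
- by case: fintype.split.
- rewrite (@big_split_ord _ _ _ N.+1 N.+1) /=.
  under [X in _ = X + _]eq_bigr do rewrite (unsplitK (inl _)).
  under [X in _ = _ + X]eq_bigr do rewrite (unsplitK (inr _)).
  by rewrite !scaler_sumr; congr (_ + _); apply: eq_bigr => i _; rewrite scalerA.
Qed.

Lemma sub_hull m K : K `<=` hull m.+1 K.
Proof.
move=> x Kx; exists (fun i => (i == ord0)%:R), (fun=> x); split=> //.
  by rewrite (bigD1 ord0) //= big1 ?addr0 // => i /negPf ->.
by rewrite (bigD1 ord0) //= big1 ?addr0 ?scale1r // => i /negPf ->; rewrite scale0r.
Qed.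

End ConvexGeometry.

(** * Strict separation of a compact set from a point *)

Section Separation.
Variables (R : realType) (N : nat).
Implicit Types (K A H : set 'rV[R]_N) (w x y b : 'rV[R]_N).

Lemma dot_gt0 x : x != 0 -> 0 < dot x x.
Proof.
move=> x0; rewrite lt_neqAle eq_sym sumr_ge0 ?andbT => [|i _]; last by rewrite -expr2 sqr_ge0.
apply: contra x0 => h; apply/eqP/rowP => i; rewrite mxE; apply/eqP.
have := h; rewrite psumr_eq0 => [/allP /(_ i (mem_index_enum _)) /=|j _].
  by rewrite mulf_eq0 orbb.
by rewrite -expr2 sqr_ge0.
Qed.

Lemma dot_sqrD x y (t : R) :
  dot (x + t *: y) (x + t *: y) = dot x x + 2 * t * dot x y + t ^+ 2 * dot y y.
Proof.
rewrite dotDr [dot _ x]dotC [dot _ (t *: y)]dotC !dotDr !dotZr.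
by rewrite ![dot (t *: y) _]dotC !dotZr; ring.
Qed.

Lemma dot_sqr_continuous b : continuous (fun x => dot (x - b) (x - b)).
Proof.
have -> : (fun x => dot (x - b) (x - b)) =
    \sum_i (fun x : 'rV[R]_N => (x 0 i - b 0 i) * (x 0 i - b 0 i)).
  by apply: funext => x; rewrite fct_sumE; apply: eq_bigr => i _; rewrite !mxE.
elim/big_ind: _ => [|f g cf cg|i _] x.
- exact: cst_continuous.
- by apply: continuousD; [exact: cf|exact: cg].
- have h : {for x, continuous (fun x : 'rV[R]_N => x 0 i - b 0 i)}.
    by apply: continuousB; [exact: coord_continuous|exact: cst_continuous].
  exact: (continuousM h h).
Qed.

(** Take the point [z] of the compact convex hull nearest to [b] in the Euclidean distance, and
    [b - z] as normal vector; [z] differs from [b] because the hull lies in [A]. *)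
Lemma strict_separation K A b : K !=set0 -> compact K -> K `<=` A -> convex_set A -> ~ A b ->
  exists w (c : R), c < dot w b /\ forall x, K x -> dot w x <= c.
Proof.
move=> [k Kk] cK KA cA Ab; pose H := hull N.+1 K.
have cH : compact H by exact: compact_hull.
have H0 : H !=set0 by exists k; exact: sub_hull.
have [|z] := @EVT_min_rV R N (fun x => dot (x - b) (x - b)) H H0 cH.
  by apply: continuous_subspaceT; exact: dot_sqr_continuous.
rewrite inE => Hz zmin.
have zb : z - b != 0.
  apply/eqP => /subr0_eq zb; apply: Ab; rewrite -zb.
  exact: (hull_sub cA KA Hz).
exists (b - z), (dot (b - z) z); split.
  by rewrite -subr_gt0 -dotBr dot_gt0 // -opprB oppr_eq0.
move=> x Kx; rewrite -subr_ge0 -dotBr leNgt; apply/negP.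
rewrite dotBr -opprB oppr_lt0 -dotBr => neg.
set D := dot (b - z) (x - z) in neg.
have D0 : 0 < D by rewrite /D.
pose E := dot (x - z) (x - z).
have E0 : 0 <= E by apply: sumr_ge0 => i _; rewrite -expr2 sqr_ge0.
(* Moving from [z] towards [x] by [t] lowers the squared distance to [b] by [2 t D - t^2 E], which
   is positive once [t E <= D]; the [+ 1] avoids division by zero. *)
pose t := Num.min 1 (D / (E + 1)).
have t0 : 0 < t by rewrite lt_min ltr01 divr_gt0 // ltr_wpDl.
have t1 : t <= 1 by rewrite ge_min lexx.
have Hx : H (t *: x + (1 - t) *: z).
  by move/convex_setP: (@hull_convex R N K); apply => //; [exact: sub_hull|exact: ltW].
have := zmin _ (mem_set Hx).
have -> : t *: x + (1 - t) *: z - b = (z - b) + t *: (x - z).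
  by apply/rowP => i; rewrite !mxE; ring.
have aD : dot (z - b) (x - z) = - D by rewrite /D ![dot _ (x - z)]dotC -dotNr opprB.
rewrite dot_sqrD aD -/E.
have tE : t * E <= D.
  apply: (@le_trans _ _ (t * (E + 1))); first by apply: ler_wpM2l; [exact: ltW|rewrite lerDl].
  by rewrite -ler_pdivlMr ?ltr_wpDl // ge_min lexx orbT.
nra.
Qed.

Lemma rational_vector (e : R) w : 0 < e ->
  exists s, forall i, `|center (RealSpace R N) s 0 i - w 0 i| <= e.
Proof.
move=> e0; have /choice[f hf] : forall i : 'I_N, exists s, `|real_center s - w 0 i| <= e.
  by move=> i; exact: rational_code.
exists (seqcode [seq f i | i <- enum 'I_N]) => i; rewrite mxE proj_seqcode.
by rewrite (nth_map i) ?size_enum_ord // nth_ord_enum.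
Qed.

Lemma rational_separation K A b : compact K -> K `<=` A -> convex_set A -> ~ A b ->
  exists s t : nat, real_center t < dot (center (RealSpace R N) s) b /\
    forall x, K x -> dot (center (RealSpace R N) s) x < real_center t.
Proof.
move=> cK KA cA Ab; have [K0|] := pselect (K !=set0); last first.
  move=> /set0P/negP/negPn/eqP ->.
  (* For empty [K] the zero functional works with any negative bound; approximating [-2] within 1
     gives one. *)
  exists 0%N; have [t ht] := rational_code (ltr01 : 0 < 1 :> R) (- 2); exists t; split=> //.
  have -> : dot (center (RealSpace R N) 0%N) b = 0.
    by apply: big1 => i _; rewrite mxE /real_center !proj0n mulr0 !mul0r.
  by move: ht; rewrite ler_distl; lra.
have [w [c [cb hc]]] := strict_separation K0 cK KA cA Ab.
have [M M0 hM] : exists2 M : R, 0 < M & forall x, K x \/ x = b -> `|x| <= M.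
  have /compact_bounded[M0 [_ hM]] := cK.
  exists (Num.max `|M0 + 1| `|b| + 1); first by rewrite ltr_wpDl // le_max normr_ge0.
  move=> x [Kx|->]; last by rewrite ler_wpDr // le_max lexx orbT.
  apply: hM => //; apply: (@lt_le_trans _ _ (M0 + 1)); first by rewrite ltrDl.
  by rewrite ler_wpDr // le_max ler_norm.
pose g := dot w b - c; have g0 : 0 < g by rewrite subr_gt0.
(* Replacing [w] then changes the functional by at most [g/8] on [K] and [b], and the bound near
   [c + g/2] is off by at most [g/8], so the gap [g] absorbs all errors. *)
pose e := g / (8 * (N.+1%:R * M)).
have e0 : 0 < e by rewrite divr_gt0 // !mulr_gt0.
have [s hs] := rational_vector w e0; set w' := center _ s in hs *.
have g8 : 0 < g / 8 by rewrite divr_gt0.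
have [t ht] := rational_code g8 (c + g / 2).
exists s, t.
have hx x : K x \/ x = b -> `|dot w' x - dot w x| <= g / 8.
  move=> /hM xM; rewrite dotC [dot w x]dotC -dotBr dotC.
  apply: le_trans (dot_le _ _) _.
  have n1 : norm1 (w' - w) <= N.+1%:R * e.
    apply: (@le_trans _ _ (\sum_(i < N) e)).
      by apply: ler_sum => i _; rewrite !mxE; have := hs i; rewrite mxE.
    rewrite sumr_const card_ord -[X in X <= _]mulr_natl.
    by apply: ler_wpM2r; [exact: ltW|rewrite ler_nat].
  apply: (@le_trans _ _ (N.+1%:R * e * M)); first by apply: ler_pM => //; exact: norm1_ge0.
  rewrite /e le_eqVlt; apply/orP; left; apply/eqP.
  have : N.+1%:R != 0 :> R by rewrite pnatr_eq0.
  by move: (N.+1%:R) => n n0; field; rewrite n0 gt_eqF.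
have hb := hx b (or_intror erefl).
move: ht hb; rewrite !ler_distl => /andP[h1 h2] /andP[h3 h4].
split=> [|x Kx].
  by move: h1 h2 h3 h4; rewrite /g; lra.
have := hx x (or_introl Kx); have := hc x Kx; rewrite ler_distl.
by move: h1 h2 h3 h4; rewrite /g => h1 h2 h3 h4 h5 /andP[h6 h7]; lra.
Qed.

End Separation.

(** * Approximations of analytic sets *)

(** The cluster point is built entry by entry through prefixes shared by [f n] for arbitrarily large
    [n]; only finitely many values below [a] compete for the next entry. *)
Lemma konig (f : nat -> baire) (a : baire) :
  (forall n i, (i < n)%N -> (f n i <= a i)%N) ->
  exists s : baire, (forall i, s i <= a i)%N /\
    forall m, exists2 n, (m <= n)%N & forall i, (i < m)%N -> f n i = s i.
Proof.
move=> fa.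
pose often (p : seq nat) := forall m, exists2 n, (m <= n)%N & mkseq (f n) (size p) = p.
have /choice[g hg] : forall p, exists v, often p -> (v <= a (size p))%N /\ often (rcons p v).
  move=> p; have [op|//] := pselect (often p); last by exists 0%N.
  apply: contrapT => /forallNP hn.
  have /choice[M hM] : forall v, exists M, (v <= a (size p))%N ->
      forall n, (M <= n)%N -> mkseq (f n) (size p).+1 <> rcons p v.
    move=> v; have [va|//] := boolP (v <= a (size p))%N; last by exists 0%N.
    apply: contrapT => /forallNP hM; apply: (hn v) => _; split=> // m.
    have /not_implyP[_ /existsNP[n /not_implyP[mn /contrapT e]]] := hM m.
    by exists n => //; rewrite size_rcons.
  (* Beyond [B] no admissible next value occurs any more, yet [p] still does. *)
  pose B := (\max_(v < (a (size p)).+1) M v + (size p).+1)%N.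
  have [n Bn e] := op B.
  have fv : (f n (size p) <= a (size p))%N.
    by apply: fa; apply: leq_trans Bn; rewrite /B leq_addl.
  apply: (hM _ fv n).
    apply: leq_trans Bn; apply: leq_trans (leq_addr _ _).
    exact: (@leq_bigmax _ (fun v : 'I__ => M v) (Ordinal (fv : (_ < (a (size p)).+1)%N))).
  by rewrite mkseqS e.
pose P := fix P n := if n is n'.+1 then rcons (P n') (g (P n')) else [::].
have sP n : size (P n) = n by elim: n => //= n IH; rewrite size_rcons IH.
have oP n : often (P n).
  by elim: n => [m|n IH]; [exists m|exact: (hg _ IH).2].
exists (fun n => g (P n)); split=> [i|m].
  by rewrite -{2}(sP i); exact: (hg _ (oP i)).1.
have [n mn e] := oP m m; exists n => // i im.
have PE k : P k = mkseq (fun n => g (P n)) k by elim: k => //= k {1}->; rewrite mkseqS.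
rewrite sP in e; have := congr1 (fun p => nth 0%N p i) (etrans e (PE m)).
by rewrite !nth_mkseq.
Qed.

Definition rad (R : realType) (n : nat) : R := n.+1%:R^-1.

Lemma recR_rad (R : realType) k (f : ctx k -> nat) : rec f -> recR (fun x => rad R (f x)).
Proof. by move=> rf; rewrite /rad; rec_auto. Qed.
#[local] Hint Resolve recR_rad : rec.

Lemma rad0 (R : realType) : rad R 0 = 1.
Proof. exact: invr1. Qed.

Section Scheme.
Variables (R : realType) (N : nat).
Local Notation RS := (RealSpace R N).
Local Notation rad := (rad R).

Implicit Types (a s : baire) (x : 'rV[R]_N).

Lemma rad_gt0 n : 0 < rad n. Proof. by rewrite invr_gt0. Qed.

Lemma rad_le m n : (m <= n)%N -> rad n <= rad m.
Proof. by move=> mn; rewrite /rad lef_pV2 ?posrE // ler_nat. Qed.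

Lemma rad_small (e : R) : 0 < e -> exists n, rad n < e.
Proof.
by move=> e0; have [n] := ltr_add_invr e0; rewrite add0r; exists n.
Qed.

Lemma le_rad (z c : R) : (forall m, exists2 n, (m <= n)%N & z <= c + rad n) -> z <= c.
Proof.
move=> h; rewrite leNgt; apply/negP; rewrite -subr_gt0 => /rad_small[m hm].
by have [n /rad_le mn zc] := h m; lra.
Qed.

(* A sequence [s] describes the pair of a point of the space, known up to [rad n]
   as [approx s n], and of the element [n |-> proj (s n) 0] of Baire space. *)
Definition approx s n : 'rV[R]_N := center RS (proj (s n) 1).

Definition lims s x := forall n, `|x - approx s n| <= rad n.

(** A decidable sufficient condition for the ball [a i] to contain every pair compatible with stage
    [m]: points within [rad m] of [approx s m], and sequences with the first [m] values given by
    [s]. Differences from place [m] on cost at most [rad m]. *)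
Definition covers a s m i : bool :=
  [&& rad m < (q (proj (a i) 1) : R),
   [forall j : 'I_N, `|real_center (proj (proj (proj (a i) 0) 0) j) -
        real_center (proj (proj (s m) 1) j)| + rad m < q (proj (a i) 1)] &
   all (fun l => (proj (s l) 0 != proj (proj (proj (a i) 0) 1) l) ==>
                 (rad l < q (proj (a i) 1))) (iota 0 m)].

(** The first conjunct makes the approximations coherent, so that infinite branches converge; all
    entries consulted have index below [n]. *)
Definition alive a s n : bool :=
  all (fun m =>
    [forall j : 'I_N, all (fun k =>
       `|real_center (proj (proj (s m) 1) j) - real_center (proj (proj (s k) 1) j)| <=
       rad m + rad k) (iota 0 m)] &&
    all (fun i => ~~ covers a s m i) (iota 0 m)) (iota 0 n).

Lemma alive_ext a a' s s' n :
  (forall i, (i < n)%N -> a i = a' i /\ s i = s' i) -> alive a s n = alive a' s' n.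
Proof.
move=> h; apply: eq_in_all => m; rewrite mem_iota add0n => /andP[_ mn].
have sm : s m = s' m by case: (h m mn).
have sl l : l \in iota 0 m -> a l = a' l /\ s l = s' l.
  by rewrite mem_iota add0n => /andP[_ lm]; apply: h; exact: ltn_trans mn.
congr (_ && _).
  by apply: eq_forallb => j; apply: eq_in_all => k /sl[_ ->]; rewrite sm.
apply: eq_in_all => i /sl[ai _]; congr (~~ _); rewrite /covers ai sm.
by congr [&& _, _ & _]; apply: eq_in_all => l /sl[_ ->].
Qed.

Lemma alive_le a s m n : (m <= n)%N -> alive a s n -> alive a s m.
Proof.
move=> mn /allP h; apply/allP => k; rewrite !mem_iota !add0n => /andP[_ km].
by apply: h; rewrite mem_iota; exact: leq_trans mn.
Qed.

Definition branch a s := forall n, alive a s n.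

Lemma norm_rV_lt x (r : R) : 0 < r -> (forall j, `|x 0 j| < r) -> `|x| < r.
Proof.
move=> r0 h; rewrite [ltLHS]/Num.norm /= mx_normrE; apply/bigmax_ltP; split=> // -[i j] _ /=.
by rewrite ord1.
Qed.

Lemma covers_nball a s m i x (g : baire) :
  `|x - approx s m| <= rad m -> (forall l, (l < m)%N -> g l = proj (s l) 0) ->
  covers a s m i -> nball (pprod RS (BaireSpace R)) (a i) (x, g).
Proof.
move=> xm gm /and3P[r1 /forallP r2 /allP r3].
have r0 : (0 : R) < q (proj (a i) 1) by apply: lt_trans r1; exact: rad_gt0.
rewrite /nball /= gt_max; apply/andP; split.
  apply: norm_rV_lt => // j; rewrite !mxE; apply: le_lt_trans (r2 j).
  have := coord_le (x - approx s m) j; rewrite !mxE => h.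
  rewrite -[X in `|X|](subrKA (real_center (proj (proj (s m) 1) j))).
  apply: le_trans (ler_normD _ _) _; rewrite lerD2l distrC.
  exact: le_trans h xm.
apply/baire_dist_lt; split=> // l ne; have [lm|ml] := ltnP l m.
  have := r3 l; rewrite mem_iota add0n => /(_ lm)/implyP; apply.
  by rewrite -gm // eq_sym.
by apply: le_lt_trans r1; exact: rad_le.
Qed.

Lemma nball_covers a s i x (g : baire) :
  lims s x -> (forall l, g l = proj (s l) 0) ->
  nball (pprod RS (BaireSpace R)) (a i) (x, g) -> exists m0, forall m, (m0 <= m)%N ->
  covers a s m i.
Proof.
move=> sx gs; rewrite /nball /= gt_max => /andP[h1 /baire_dist_lt[r0 h2]].
set r := q _ in h1 r0 h2 *.
(* Half the slack: passing from [x] to [approx s m] costs one [rad m], and [covers] asks for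
   another. *)
have e0 : 0 < (r - `|center RS (proj (proj (a i) 0) 0) - x|) / 2.
  by rewrite divr_gt0 // subr_gt0.
have [m0 hm0] := rad_small e0; exists m0 => m /rad_le mm0.
have := normr_ge0 (center RS (proj (proj (a i) 0) 0) - x) => n0.
apply/and3P; split; rewrite -/r.
- by lra.
- apply/forallP => j.
  have := coord_le (center RS (proj (proj (a i) 0) 0) - x) j.
  have := le_trans (coord_le (x - approx s m) j) (sx m).
  rewrite !mxE => c1 c2; rewrite -[X in `|X|](subrKA (x 0 j)).
  have := ler_normD (real_center (proj (proj (proj (a i) 0) 0) j) - x 0 j)
     (x 0 j - real_center (proj (proj (s m) 1) j)).
  by lra.
- apply/allP => l _; apply/implyP => ne; apply: h2.
  by rewrite gs eq_sym.
Qed.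

(** A covering at a finite stage would put the pair into the open complement; conversely a ball
    containing the pair covers it from some stage on. *)
Lemma G1set_branch a x : G1set RS a x <-> exists2 s, branch a s & lims s x.
Proof.
split=> [[g gF]|[s sb sx]].
  have /choice[y hy] : forall n, exists y, `|x - center RS y| <= rad n.
    move=> n; have [y hy] := rational_vector x (rad_gt0 n); exists y.
    apply: norm_le; first exact/ltW/rad_gt0.
    by move=> i; have := hy i; rewrite !mxE distrC.
  pose s n := seqcode [:: g n; y n].
  have sx : lims s x by move=> n; rewrite /approx /s proj_seqcode /=; exact: hy.
  exists s => // n; apply/allP => m _; apply/andP; split.
    apply/forallP => j; apply/allP => k _.
    have := le_trans (coord_le (x - approx s m) j) (sx m).
    have := le_trans (coord_le (x - approx s k) j) (sx k).
    rewrite !mxE !ler_distl => /andP[? ?] /andP[? ?].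
    by apply/andP; split; lra.
  apply/allP => i _; apply/negP => hc; apply: gF; exists i => //.
  apply: covers_nball hc; first exact: sx.
  by move=> l _; rewrite /s proj_seqcode.
exists (fun l => proj (s l) 0) => -[i _ /(nball_covers sx) h].
have [m0 hm] := h (fun=> erefl).
(* Late enough for the covering to be visible and for the index [i] to be among those tested. *)
have /allP/(_ (maxn m0 i.+1)) := sb (maxn m0 i.+1).+1.
rewrite mem_iota add0n /= => /(_ (leqnn _))/andP[_ /allP/(_ i)].
rewrite mem_iota add0n /= leq_max ltnSn orbT => /(_ isT).
by rewrite hm // leq_maxl.
Qed.

Lemma alive_approx a s n m k (j : 'I_N) : alive a s n -> (m < n)%N -> (k < n)%N ->
  `|approx s m 0 j - approx s k 0 j| <= rad m + rad k.
Proof.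
move=> /allP h; wlog km : m k / (k <= m)%N.
  move=> H mn kn; case: (leqP k m) => [km|/ltnW mk]; first exact: H.
  by rewrite distrC [rad m + _]addrC; exact: H.
move=> mn _; rewrite !mxE; move: km; rewrite leq_eqVlt => /orP[/eqP ->|km].
  by rewrite subrr normr0 addr_ge0 // ltW // rad_gt0.
have /andP[/forallP/(_ j)/allP/(_ k) hk _] := h m (ltac:(by rewrite mem_iota)).
by apply: hk; rewrite mem_iota.
Qed.

(** In each coordinate the closed intervals of radius [rad n] meet pairwise, so the supremum of
    their left ends lies in all of them. *)
Lemma branch_lims a s : branch a s -> exists x, lims s x.
Proof.
move=> sb.
have ub j n k : approx s n 0 j - rad n <= approx s k 0 j + rad k.
  have := @alive_approx a s (n + k).+1 n k j (sb _) (ltac:(by lia)) (ltac:(by lia)).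
  by rewrite ler_distl => /andP[_]; lra.
pose E j := range (fun n => approx s n 0 j - rad n).
exists (\row_j sup (E j)) => n; apply: norm_le => [|j]; first exact/ltW/rad_gt0.
rewrite !mxE ler_distl.
have hE k : ubound (E j) (approx s k 0 j + rad k) by move=> _ [n' _ <-]; exact: ub.
have EE : E j !=set0 by exists (approx s 0%N 0 j - rad 0); exists 0%N.
apply/andP; split.
  have := ub_le_sup (ex_intro _ _ (hE 0%N)) (ex_intro2 _ _ n I erefl).
  by rewrite !mxE.
by have := ge_sup EE (hE n); rewrite !mxE.
Qed.

End Scheme.

(** * The tree of separations *)

Section Leaves.
Variables (R : realType) (N : nat).
Local Notation RS := (RealSpace R N).
Local Notation rad := (rad R).
Local Notation alive := (@alive R N).
Local Notation branch := (@branch R N).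
Local Notation approx := (@approx R N).
Implicit Types (a b s : baire) (x : 'rV[R]_N) (n u v w c t : nat).

Definition below a (e : baire) : set 'rV[R]_N :=
  [set x | exists s, [/\ forall i, (s i <= e i)%N, branch a s & lims s x]].

Lemma approx_ext s s' n : s n = s' n -> approx s n = approx s' n.
Proof. by move=> e; rewrite /approx e. Qed.

Lemma approx0_le s j : `|approx s 0%N 0 j| <= (s 0%N)%:R :> R.
Proof.
rewrite mxE; apply: le_trans (real_center_le _ _) _.
by rewrite ler_nat (leq_trans (proj_le _ _)) // proj_le.
Qed.

Lemma lims_bounded s x j : lims s x -> `|x 0 j| <= (s 0%N)%:R + 1.
Proof.
move=> /(_ 0%N); rewrite rad0 => h.
have := le_trans (coord_le (x - approx s 0%N) j) h; have := approx0_le s j.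
by rewrite !mxE !ler_norml => /andP[? ?] /andP[? ?]; apply/andP; split; lra.
Qed.

(** The first approximation bounds the set. For [x] in the closure, descriptions of points within
    [rad n] of [x] cluster, by Koenig's lemma, at a description of [x] itself. *)
Lemma compact_below a e : compact (below a e).
Proof.
apply: bounded_closed_compact.
  exists ((e 0%N)%:R + 1); split=> [|M hM x [s [se _ sx]]]; first exact: num_real.
  apply: norm_le => [|j]; first by apply: le_trans (ltW hM); rewrite addr_ge0.
  apply: le_trans (ltW hM); apply: le_trans (lims_bounded j sx) _.
  by rewrite lerD2r ler_nat.
move=> x xcl.
have /choice[f hf] : forall n, exists s, [/\ forall i, (s i <= e i)%N, branch a s &
    exists2 y, lims s y & `|x - y| < rad n].
  move=> n; have [y [[s [se sb sy]] xy]] := xcl _ (nbhsx_ballx x _ (rad_gt0 R n)).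
  exists s; split=> //; exists y => //.
  by move: xy; rewrite -ball_normE.
have [s [se sf]] := @konig f e (fun n i _ => let: And3 h _ _ := hf n in h i).
exists s; split=> // n.
  have [k _ hk] := sf n; have [_ /(_ n) kb _] := hf k.
  by rewrite -(@alive_ext _ _ a a (f k)) // => i /hk.
apply: le_rad => m; have [k mk hk] := sf (maxn m n.+1); exists k.
  by apply: leq_trans mk; rewrite leq_maxl.
have [_ _ [y ky xy]] := hf k.
rewrite -(@approx_ext (f k)) ?hk ?leq_max ?ltnSn ?orbT //.
apply: le_trans (ler_distD y _ _) _; rewrite [rad n + _]addrC.
by apply: lerD; [exact: ltW|exact: ky].
Qed.

Local Notation W w := (center RS w : 'rV[R]_N).

(** [norm1 (W w) * rad n.-1] is the largest change of the functional between a point and its last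
    approximation. Every sequence below [u] of the same length has a code at most [u], so the test
    is finite. *)
Definition good a n u v w c : bool :=
  (real_center c + norm1 (W w) * rad n.-1 < dot (W w) (approx (proj v) n.-1)) &&
  all (fun s : nat => (all (fun i => proj s i <= proj u i)%N (iota 0 n) && alive a (proj s) n) ==>
        (dot (W w) (approx (proj s) n.-1) + norm1 (W w) * rad n.-1 <= real_center c))
      (iota 0 u.+1).

Definition leaf a b n u v : bool :=
  (0 < n)%N && (~~ alive b (proj v) n ||
    has (fun w => has (good a n u v w) (iota 0 n)) (iota 0 n)).

Definition prefix e n := seqcode (mkseq e n).

Lemma proj_prefix e n i : (i < n)%N -> proj (prefix e n) i = e i.
Proof. by move=> lin; rewrite proj_seqcode nth_mkseq. Qed.

Lemma prefix_le e e' n : (forall i, (i < n)%N -> (e i <= e' i)%N) ->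
  (prefix e n <= prefix e' n)%N.
Proof.
move=> h; apply: seqcode_le; rewrite !size_mkseq // => i lin.
by rewrite !nth_mkseq // h.
Qed.

Lemma eq_alive a s s' n : (forall i, (i < n)%N -> s i = s' i) ->
  alive a s n = alive a s' n.
Proof. by move=> h; apply: alive_ext => i /h. Qed.

Lemma goodP a n e v w c : (0 < n)%N ->
  reflect (real_center c + norm1 (W w) * rad n.-1 < dot (W w) (approx (proj v) n.-1) /\
    forall s, (forall i, (i < n)%N -> (s i <= e i)%N) -> alive a s n ->
      dot (W w) (approx s n.-1) + norm1 (W w) * rad n.-1 <= real_center c)
  (good a n (prefix e n) v w c).
Proof.
move=> n0; have ns : (n.-1 < n)%N by rewrite prednK.
apply: (iffP andP) => -[h1 h2]; split=> //.
  move=> s se sa; move/allP: h2 => /(_ (prefix s n)).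
  rewrite mem_iota add0n ltnS prefix_le // => /(_ isT)/implyP.
  rewrite (@approx_ext (proj (prefix s n)) s) ?proj_prefix //; apply.
  rewrite (@eq_alive _ _ s) ?sa ?andbT => [|i]; last exact: proj_prefix.
  by apply/allP => i; rewrite mem_iota add0n => lin; rewrite !proj_prefix // se.
apply/allP => s _; apply/implyP => /andP[/allP sle sa]; apply: h2 => // i lin.
by have := sle i; rewrite mem_iota add0n proj_prefix // => /(_ lin).
Qed.

(** All good half-spaces below [n] are imposed, which avoids selecting one; the box gives
    compactness, its [+ 1] being [rad 0]. *)
Definition leaf_set a n u v : set 'rV[R]_N :=
  [set x : 'rV[R]_N | (forall j, `|x 0 j| <= (proj u 0)%:R + 1) /\
    forall w c, (w < n)%N -> (c < n)%N -> good a n u v w c -> dot (W w) x <= real_center c].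

Lemma leaf_set_above a b n e v x s : leaf a b n (prefix e n) v -> branch a s -> lims s x ->
  (forall i, (i < n)%N -> (s i <= e i)%N) -> leaf_set a n (prefix e n) v x.
Proof.
move=> /andP[n0 _] sb sx se; split=> [j|w c _ _ /(goodP _ _ _ _ _ n0)[_ h]].
  apply: le_trans (lims_bounded j sx) _; rewrite lerD2r ler_nat.
  by rewrite proj_prefix // se.
apply: le_trans (h s se (sb n)).
rewrite -lerBlDl -dotBr; apply: le_trans (ler_norm _) _.
by apply: le_trans (dot_le _ _) _; rewrite ler_wpM2l ?norm1_ge0.
Qed.

Lemma leaf_set_disjoint a b n u v x s : leaf a b n u v -> branch b s -> lims s x ->
  (forall i, (i < n)%N -> s i = proj v i) -> ~ leaf_set a n u v x.
Proof.
move=> /andP[n0 /orP[nv|/hasP[w wn hc]]] sb sx sv.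
  by move: nv; rewrite -(@eq_alive _ s) // sb.
move: wn hc; rewrite mem_iota add0n => /andP[_ wn] /hasP[c].
rewrite mem_iota add0n => /andP[_ cn] g [_ /(_ w c wn cn g)].
move: g => /andP[h _]; apply/negP; rewrite -ltNge.
move: h; rewrite -(@approx_ext s) ?sv ?prednK // -ltrBrDr => /lt_le_trans; apply.
rewrite lerBlDl -lerBlDr -dotBr; apply: le_trans (ler_norm _) _.
apply: le_trans (dot_le _ _) _; rewrite ler_wpM2l ?norm1_ge0 //.
by rewrite distrC.
Qed.

(* The tree of pairs of sequences is well founded above the leaves: along a path, the
   bounded sequences in the scheme of [a] yield a compact subset of the convex set,
   while the scheme of [b] shrinks to a point outside. *)
Lemma leaf_exists a b (e d : baire) :
  G1set RS a `&` G1set RS b = set0 -> convex_set (G1set RS a : set 'rV[R]_N) ->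
  exists n, leaf a b n (prefix e n) (prefix d n).
Proof.
move=> ab0 ca; apply: contrapT => /forallNP nl.
(* A dead prefix of [d] would already be a leaf, so [d] is a branch and describes a point [y]. *)
have db n : alive b (proj (prefix d n.+1)) n.+1.
  have /negP := nl n.+1; rewrite negb_and negb_or negbK /=.
  by move=> /andP[].
have dbr : branch b d.
  move=> n; apply: (alive_le (leqnSn n)).
  by rewrite -(@eq_alive _ (proj (prefix d n.+1))) // => i; exact: proj_prefix.
have [y dy] := branch_lims dbr.
have ay : ~ G1set RS a y.
  move=> ay; suff : (G1set RS a `&` G1set RS b) y by rewrite ab0.
  by split=> //; apply/G1set_branch; exists d.
have sub : below a e `<=` G1set RS a.
  by move=> x [s [_ sb sx]]; apply/G1set_branch; exists s.
have [w [c [cy hc]]] := rational_separation (@compact_below a e) sub ca ay.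
pose l := norm1 (W w); have l0 : 0 <= l := norm1_ge0 _.
have [n0 hn0] : exists n0, 2 * l * rad n0 < dot (W w) y - real_center c.
  have g0 : 0 < dot (W w) y - real_center c by rewrite subr_gt0.
  have [n0 h0] := @rad_small R ((dot (W w) y - real_center c) / (2 * l + 1))
     (ltac:(by rewrite divr_gt0 // ltr_wpDl // mulr_ge0)).
  exists n0; apply: (@le_lt_trans _ _ (rad n0 * (2 * l + 1))).
    by have := rad_gt0 R n0; nra.
  by rewrite -ltr_pdivlMr // ltr_wpDl // mulr_ge0.
(* At stages beyond [w], [c] and [n0] the inequality for [y] holds, so [good] can fail only through
   some bounded sequence still alive. *)
have bad n : exists s, [/\ forall i, (i < n)%N -> (s i <= e i)%N,
    alive a s (maxn n (maxn n0 (maxn w c)).+2) &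
    ~ dot (W w) (approx s (maxn n (maxn n0 (maxn w c)).+2).-1) +
      l * rad (maxn n (maxn n0 (maxn w c)).+2).-1 <= real_center c].
  set k := maxn n _.
  have kn : (n <= k)%N by rewrite leq_maxl.
  have kw : (w < k)%N by rewrite /k; lia.
  have kc : (c < k)%N by rewrite /k; lia.
  have kn0 : (n0 <= k.-1)%N by rewrite /k; lia.
  have k0 : (0 < k)%N by rewrite /k; lia.
  have : ~ good a k (prefix e k) (prefix d k) w c.
    move=> g; apply: (nl k); apply/andP; split=> //; apply/orP; right.
    apply/hasP; exists w; first by rewrite mem_iota.
    by apply/hasP; exists c; first by rewrite mem_iota.
  move=> ng; apply: contrapT => /forallNP h; apply: ng; apply/goodP => //; split.
    rewrite (@approx_ext _ d) ?proj_prefix ?prednK //.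
    have h1 := le_trans (ler_norm _) (dot_le (W w) (y - approx d k.-1)).
    have h2 := dy k.-1; have h3 := rad_le R kn0; rewrite -/l dotBr in h1 *.
    have : l * `|y - approx d k.-1| <= l * rad n0.
      by rewrite ler_wpM2l // (le_trans h2).
    have : l * rad k.-1 <= l * rad n0 by rewrite ler_wpM2l.
    by lra.
  move=> s se sa; apply: contrapT => hs; apply: (h s); split=> // i lin.
  by apply: se; exact: leq_trans kn.
have /choice[f hf] := bad.
(* The failing sequences cluster at a branch below [e], whose limit [x] belongs to the compact set
   and so lies strictly below [c]. *)
have [s [se sf]] := @konig f e (fun n => let: And3 h _ _ := hf n in h).
have sb : branch a s.
  move=> m; have [n mn hn] := sf m; have [_ fa _] := hf n.
  rewrite -(@eq_alive _ (f n)) //; apply: alive_le fa.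
  by rewrite leq_max mn.
have [x sx] := branch_lims sb.
have xc : dot (W w) x < real_center c by apply: hc; exists s.
have [m hm] : exists m, 4 * l * rad m < real_center c - dot (W w) x.
  have g0 : 0 < real_center c - dot (W w) x by rewrite subr_gt0.
  have [m h0] := @rad_small R ((real_center c - dot (W w) x) / (4 * l + 1))
     (ltac:(by rewrite divr_gt0 // ltr_wpDl // mulr_ge0)).
  exists m; apply: (@le_lt_trans _ _ (rad m * (4 * l + 1))).
    by have := rad_gt0 R m; nra.
  by rewrite -ltr_pdivlMr // ltr_wpDl // mulr_ge0.
(* Since [f n] agrees with [s] at [m], its last approximation is within [3 * rad m] of [x]; with the
   margin of [good] the total error is at most [4 * l * rad m], contradicting the failure. *)
have [n mn hn] := sf m.+1; have [_ fa] := hf n; apply.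
move: fa; set k := maxn n _ => fa.
have mk : (m < k)%N by apply: leq_trans mn _; rewrite leq_maxl.
have k0 : (0 < k)%N by lia.
have rk : rad k.-1 <= rad m by apply: rad_le; rewrite -ltnS prednK.
have close : `|approx (f n) k.-1 - x| <= 3 * rad m.
  apply: norm_le => [|j]; first by rewrite mulr_ge0 // ltW // rad_gt0.
  have kk : (k.-1 < k)%N by rewrite prednK.
  have h1 := alive_approx j fa kk mk.
  have h2 := le_trans (coord_le (x - approx s m) j) (sx m).
  move: h1 h2; rewrite -(@approx_ext (f n) s) ?hn // !mxE => h1 h2.
  rewrite -[X in `|X|](subrKA (real_center (proj (proj (f n m) 1) j))).
  apply: le_trans (ler_normD _ _) _.
  by rewrite [X in _ + X]distrC; lra.
have h1 := le_trans (ler_norm _) (dot_le (W w) (approx (f n) k.-1 - x)).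
rewrite dotBr -/l in h1.
have h2 : l * `|approx (f n) k.-1 - x| <= l * (3 * rad m) by rewrite ler_wpM2l.
have h3 : l * rad k.-1 <= l * rad m by rewrite ler_wpM2l.
by lra.
Qed.

End Leaves.

Section LeafCodes.
Variables (R : realType) (N : nat).
Local Notation RS := (RealSpace R N).
Local Notation W w := (center RS w : 'rV[R]_N).
Implicit Types (a b e s : baire) (x : 'rV[R]_N) (n u v w c t : nat).

(* The ball [t] lies outside one of the half-spaces that define [leaf_set]. *)
Definition excluded a n u v t : bool :=
  [exists j : 'I_N, (proj u 0)%:R + 1 + q (proj t 1) <=
     `|real_center (proj (proj t 0) j) : R| ] ||
  has (fun w => has (fun c => good R N a n u v w c &&
        (real_center c + q (proj t 1) * norm1 (W w) < dot (W w) (W (proj t 0))))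
      (iota 0 n)) (iota 0 n).

Lemma nball_real t x : nball RS t x = (`|W (proj t 0) - x| < q (proj t 1)).
Proof. by []. Qed.

Lemma small_ball x d : exists t, q (proj t 1) = rad R d /\ nball RS t x.
Proof.
have h : 0 < rad R d / 2 by rewrite divr_gt0 // rad_gt0.
have [s hs] := rational_vector x h.
exists (seqcode [:: s; seqcode [:: 1%N; d]]).
rewrite nball_real !proj_seqcode /= radius_code; split=> //.
apply: (@le_lt_trans _ _ (rad R d / 2)); last by rewrite -/(rad R d); have := rad_gt0 R d; lra.
by apply: norm_le => [|i]; [exact: ltW|have := hs i; rewrite !mxE].
Qed.

(** Each outside point violates one strict inequality with room to spare, so a small rational ball
    around it is [excluded]; the other indices are replaced by the empty ball [0]. *)
Lemma leaf_set_Fset a n u v :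
  Fset RS (fun t => if excluded a n u v t then t else 0%N) = leaf_set a n u v.
Proof.
apply/seteqP; split=> [x xF|x [xb xg] [t _ /=]].
  have out t : nball RS t x -> ~~ excluded a n u v t.
    by move=> tx; apply/negP => te; apply: xF; exists t => //=; rewrite te.
  split=> [j|w c wn cn g]; rewrite leNgt; apply/negP => h.
    (* Half the excess, so that the center of a ball of this size around [x] still exceeds the box
       by a full radius. *)
    have h2 : 0 < (`|x 0 j| - ((proj u 0)%:R + 1)) / 2 by rewrite divr_gt0 // subr_gt0.
    have [d dh] := rad_small h2.
    have [t [tq tx]] := small_ball x d; apply/negP: (out t tx); rewrite negbK.
    apply/orP; left; apply/existsP; exists j; rewrite tq.
    move: tx; rewrite nball_real tq => /ltW /(le_trans (coord_le _ j)).
    rewrite !mxE => tx; have := ler_normD (x 0 j - real_center (proj (proj t 0) j))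
      (real_center (proj (proj t 0) j)).
    by rewrite subrK distrC; lra.
  have l0 := norm1_ge0 (W w).
  have [d dh] := @rad_small R ((dot (W w) x - real_center c) / (2 * norm1 (W w) + 1))
     (ltac:(by rewrite divr_gt0 ?subr_gt0 // ltr_wpDl // mulr_ge0)).
  have [t [tq tx]] := small_ball x d; apply/negP: (out t tx); rewrite negbK.
  apply/orP; right; apply/hasP; exists w; first by rewrite mem_iota.
  apply/hasP; exists c; first by rewrite mem_iota.
  rewrite g andTb tq; move: tx; rewrite nball_real tq => /ltW tx.
  have h1 := le_trans (ler_norm _) (dot_le (W w) (x - W (proj t 0))).
  have h2 : norm1 (W w) * `|x - W (proj t 0)| <= norm1 (W w) * rad R d.
    by rewrite ler_wpM2l // distrC.
  have l1 : 0 < 2 * norm1 (W w) + 1 by rewrite ltr_wpDl // mulr_ge0.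
  rewrite dotBr in h1; move: dh; rewrite ltr_pdivlMr //.
  by have := rad_gt0 R d; lra.
case: ifP => [/orP[/existsP[j hj]|/hasP[w wn /hasP[c cn /andP[g hg]]]]|_]; rewrite nball_real.
- move=> /(le_lt_trans (coord_le _ j)); rewrite !mxE => h1.
  have := ler_normD (real_center (proj (proj t 0) j) - x 0 j) (x 0 j).
  by rewrite subrK; have := xb j; lra.
- move=> /ltW tx; move: wn cn; rewrite !mem_iota !add0n => /andP[_ wn] /andP[_ cn].
  have h0 := xg w c wn cn g.
  have h1 := le_trans (ler_norm _) (dot_le (W w) (W (proj t 0) - x)).
  have h2 : norm1 (W w) * `|W (proj t 0) - x| <= norm1 (W w) * q (proj t 1).
    by rewrite ler_wpM2l ?norm1_ge0.
  by rewrite dotBr in h1; lra.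
- by move=> h; apply: (@nball_empty R RS x) => //; exact: normr_ge0.
Qed.

Lemma compact_leaf_set a n u v : compact (leaf_set a n u v : set 'rV[R]_N).
Proof.
apply: bounded_closed_compact.
  exists ((proj u 0)%:R + 1); split=> [|M hM x [xb _]]; first exact: num_real.
  apply: norm_le => [|j]; first by apply: le_trans (ltW hM); rewrite addr_ge0.
  exact: le_trans (xb j) (ltW hM).
rewrite -leaf_set_Fset; apply: open_closedC; apply: bigcup_open => i _.
set t := if _ then _ else _.
have := @ball_open _ 'rV[R]_N (W (proj t 0)) (q (proj t 1)).
by rewrite -ball_normE; apply.
Qed.

Lemma convex_leaf_set a n u v : convex_set (leaf_set a n u v : set 'rV[R]_N).
Proof.
apply/convex_setP => x y k [xb xg] [yb yg] k0 k1; split=> [j|w c wn cn g].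
  rewrite !mxE; apply: le_trans (ler_normD _ _) _.
  rewrite !normrM ger0_norm // [`|1 - k|]ger0_norm ?subr_ge0 //.
  by have := xb j; have := yb j; nra.
rewrite dotDr !dotZr.
by have := xg w c wn cn g; have := yg w c wn cn g; nra.
Qed.

End LeafCodes.

(** * Decidability and locality of leaves *)

Section LeafRecursive.
Variables (R : realType) (N : nat).
Local Notation RS := (RealSpace R N).

Lemma recR_center k (f : ctx k -> nat) (i : 'I_N) : rec f ->
  recR (fun x => center RS (f x) 0 i : R).
Proof.
move=> rf; apply: (@recR_ext _ _ (fun x => real_center (proj (f x) i))).
  by move=> x; rewrite mxE.
by rec_auto.
Qed.

Lemma recR_norm1 k (f : ctx k -> nat) : rec f -> recR (fun x => norm1 (center RS (f x)) : R).
Proof.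
by move=> rf; apply: recR_sum => i; apply: recR_norm; exact: recR_center.
Qed.

Lemma recR_dot k (f g : ctx k -> nat) : rec f -> rec g ->
  recR (fun x => dot (center RS (f x)) (center RS (g x)) : R).
Proof.
by move=> rf rg; apply: recR_sum => i; apply: recR_mul; exact: recR_center.
Qed.

Lemma recb_covers k (a s m i : ctx k -> nat) : rec a -> rec s -> rec m -> rec i ->
  recb (fun x => covers R N (proj (a x)) (proj (s x)) (m x) (i x)).
Proof.
move=> ra rs rm ri.
have ra' := rec_weak ra; have rs' := rec_weak rs; have rm' := rec_weak rm.
have ri' := rec_weak ri.
by rewrite /covers; apply: recb_and; [|apply: recb_and];
  try (apply: recb_forall => j); rec_auto.
Qed.

Lemma recb_alive k (a s n : ctx k -> nat) : rec a -> rec s -> rec n ->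
  recb (fun x => alive R N (proj (a x)) (proj (s x)) (n x)).
Proof.
move=> ra rs rn.
have ra' := rec_weak ra; have rs' := rec_weak rs.
have ra2 := rec_weak ra'; have rs2 := rec_weak rs'.
rewrite /alive; apply: recb_all => //; apply: recb_and.
  by apply: recb_forall => j; apply: recb_all; rec_auto.
by apply: recb_all; [rec_auto|apply: recb_neg; apply: recb_covers; rec_auto].
Qed.

Lemma recb_good k (a n u v w c : ctx k -> nat) :
  rec a -> rec n -> rec u -> rec v -> rec w -> rec c ->
  recb (fun x => good R N (proj (a x)) (n x) (u x) (v x) (w x) (c x)).
Proof.
move=> ra rn ru rv rw rc.
have ra' := rec_weak ra; have rn' := rec_weak rn; have ru' := rec_weak ru.
have rv' := rec_weak rv; have rw' := rec_weak rw; have rc' := rec_weak rc.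
have ru2 := rec_weak ru'.
rewrite /good /approx; apply: recb_and.
  apply: recb_ltr; last by apply: recR_dot; rec_auto.
  by apply: recR_add; [rec_auto|apply: recR_mul; [exact: recR_norm1|rec_auto]].
apply: recb_all; first by rec_auto.
apply: recb_imp.
  apply: recb_and; last by apply: recb_alive; rec_auto.
  by apply: recb_all; rec_auto.
apply: recb_ler; last by rec_auto.
apply: recR_add; first by apply: recR_dot; rec_auto.
by apply: recR_mul; [exact: recR_norm1|rec_auto].
Qed.

Lemma recb_leaf k (a b n u v : ctx k -> nat) :
  rec a -> rec b -> rec n -> rec u -> rec v ->
  recb (fun x => leaf R N (proj (a x)) (proj (b x)) (n x) (u x) (v x)).
Proof.
move=> ra rb rn ru rv.
have weak2 f : rec f -> rec (fun x : ctx k.+2 => f x.1.1).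
  by move=> rf; exact: (rec_weak (rec_weak rf)).
rewrite /leaf; apply: recb_and; first by rec_auto.
apply: recb_or; first by apply: recb_neg; apply: recb_alive; rec_auto.
apply: recb_has => //; apply: recb_has; first exact: rec_weak.
by apply: recb_good; auto with rec nocore.
Qed.

Lemma recb_excluded k (a n u v t : ctx k -> nat) :
  rec a -> rec n -> rec u -> rec v -> rec t ->
  recb (fun x => excluded R N (proj (a x)) (n x) (u x) (v x) (t x)).
Proof.
move=> ra rn ru rv rt.
have weak2 f : rec f -> rec (fun x : ctx k.+2 => f x.1.1).
  by move=> rf; exact: (rec_weak (rec_weak rf)).
rewrite /excluded; apply: recb_or.
  by apply: recb_exists => j; rec_auto.
apply: recb_has => //; apply: recb_has; first exact: rec_weak.
apply: recb_and; first by apply: recb_good; auto with rec nocore.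
have rt2 := weak2 _ rt.
apply: recb_ltr; last by apply: recR_dot; rec_auto.
apply: recR_add; first by rec_auto.
by apply: recR_mul; [rec_auto|apply: recR_norm1; rec_auto].
Qed.

Lemma good_local (a a' : baire) n u v w c : (forall i, (i < n)%N -> a i = a' i) ->
  good R N a n u v w c = good R N a' n u v w c.
Proof.
move=> aa; congr (_ && _); apply: eq_all => s; congr ((_ && _) ==> _).
by apply: alive_ext => i /aa.
Qed.

Lemma leaf_local (a b a' b' : baire) n u v :
  (forall i, (i < n)%N -> a i = a' i /\ b i = b' i) ->
  leaf R N a b n u v = leaf R N a' b' n u v.
Proof.
move=> ab; congr (_ && (~~ _ || _)); first by apply: alive_ext => i /ab[].
apply: eq_has => w; apply: eq_has => c; apply: good_local => i /ab[] //.
Qed.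

Lemma excluded_local (a a' : baire) n u v t : (forall i, (i < n)%N -> a i = a' i) ->
  excluded R N a n u v t = excluded R N a' n u v t.
Proof.
move=> aa; congr (_ || _); apply: eq_has => w; apply: eq_has => c.
by rewrite (@good_local a a').
Qed.

End LeafRecursive.

(** * Codes of the separating set *)

Section Trees.
Variables (R : realType) (N : nat).
Local Notation RS := (RealSpace R N).
Implicit Types (a b s : baire) (x : 'rV[R]_N) (z m t : nat) (u v : seq nat).

(* Nodes are pairs of sequences of the same length.  The child [<i, j>] with
   [j = <k, l>] extends them by [i + k] and [l], so that the union over [i] of the
   intersection over [j] is a union of intersections over all first entries [>= i]. *)
Definition node u v : nat := seqcode [:: size u; seqcode u; seqcode v].

Definition cg_leaf a b z : bool := leaf R N a b (proj z 0) (proj z 1) (proj z 2).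

Definition cg_lab a b z : nat := if cg_leaf a b z then 0%N else 1%N.

Definition cg_dat a b z t : nat :=
  if excluded R N a (proj z 0) (proj z 1) (proj z 2) t then t else 0%N.

Definition cg_child z m : nat :=
  seqcode [:: (proj z 0).+1;
    (proj z 1 * nth_prime (proj z 0) ^ (proj m 0 + proj (proj m 1) 0).+1)%N;
    (proj z 2 * nth_prime (proj z 0) ^ (proj (proj m 1) 1).+1)%N].

Lemma cg_child_node u v m : size u = size v ->
  cg_child (node u v) m =
  node (rcons u (proj m 0 + proj (proj m 1) 0)%N) (rcons v (proj (proj m 1) 1)).
Proof.
by move=> uv; rewrite /cg_child /node !proj_seqcode /= size_rcons !seqcode_rcons uv.
Qed.

(* Three kinds of nodes: [<2, z>] and [<0, z, <z', j>>] carry the set of the node [z],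
   except that [<0, z, <z', j>>] is the [j]-th basic closed set of [z'] if [z'] is a
   leaf; [<1, z, i>] is the complement of the [i]-th intersection at [z]. *)
Definition bo_lab a b y : nat :=
  if (proj y 0 == 0%N) && cg_leaf a b (proj (proj y 2) 0) then 0%N else 1%N.

Definition bo_dat a b y t : nat := cg_dat a b (proj (proj y 2) 0) (proj (proj y 2) 1).

Definition bo_child y m : nat :=
  if proj y 0 == 1%N then
    seqcode [:: 0%N; cg_child (proj y 1) (seqcode [:: proj y 2; m]);
                seqcode [:: proj y 1; m]]
  else seqcode [:: 1%N; proj y 1; m].

Definition cg_code a b := tcode R (cg_lab a b) cg_child (cg_dat a b).
Definition bo_code a b := tcode R (bo_lab a b) bo_child (bo_dat a b).

Lemma cg_lab1 a b z : cg_lab a b z = 1%N -> cg_leaf a b z = false.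
Proof. by rewrite /cg_lab; case: ifP. Qed.

Lemma node_local a b a' b' z t : (forall i, (i <= z)%N -> a i = a' i /\ b i = b' i) ->
  cg_leaf a b z = cg_leaf a' b' z /\ cg_dat a b z t = cg_dat a' b' z t.
Proof.
move=> h; have h' i : (i < proj z 0)%N -> a i = a' i /\ b i = b' i.
  by move=> iz; apply: h; apply: leq_trans (ltnW iz) (proj_le _ _).
split; first exact: leaf_local.
by rewrite /cg_dat (@excluded_local _ _ a a') // => i /h'[].
Qed.

Lemma rec_cg_child : rec2 cg_child.
Proof. by rewrite /rec2 /cg_child; rec_auto. Qed.

Lemma rec_cg_lab : rec3 (fun a b : nat => cg_lab (proj a) (proj b)).
Proof.
rewrite /rec3 /cg_lab; apply: rec_if; try by rec_auto.
by rewrite /cg_leaf; apply: recb_leaf; rec_auto.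
Qed.

Lemma rec_cg_dat : rec4 (fun a b : nat => cg_dat (proj a) (proj b)).
Proof.
rewrite /rec4 /cg_dat; apply: rec_if; try by rec_auto.
by apply: recb_excluded; rec_auto.
Qed.

Lemma rec_bo_child : rec2 bo_child.
Proof.
have rc k := fun f g => @rec_comp2 _ k f g rec_cg_child.
by rewrite /rec2 /bo_child; rec_auto.
Qed.

Lemma rec_bo_lab : rec3 (fun a b : nat => bo_lab (proj a) (proj b)).
Proof.
rewrite /rec3 /bo_lab; apply: rec_if; try by rec_auto.
apply: recb_and; first by rec_auto.
by rewrite /cg_leaf; apply: recb_leaf; rec_auto.
Qed.

Lemma rec_bo_dat : rec4 (fun a b : nat => bo_dat (proj a) (proj b)).
Proof. by apply: (rec_comp4 rec_cg_dat); rec_auto. Qed.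

Definition root := node [::] [::].
Definition bo_root := seqcode [:: 2%N; root].

Lemma Delta11_cg_code : @Delta11_recursive R (pprod (BaireSpace R) (BaireSpace R))
  (BaireSpace R) (fun ab => cg_code ab.1 ab.2 root).
Proof.
apply: (@Delta11_tcode _ cg_lab _ cg_dat _ rec_cg_lab rec_cg_child rec_cg_dat).
move=> a b a' b' z h; split; first by rewrite /cg_lab (node_local 0 h).1.
by apply: funext => t; exact: (node_local t h).2.
Qed.

Lemma Delta11_bo_code : @Delta11_recursive R (pprod (BaireSpace R) (BaireSpace R))
  (BaireSpace R) (fun ab => bo_code ab.1 ab.2 bo_root).
Proof.
apply: (@Delta11_tcode _ bo_lab _ bo_dat _ rec_bo_lab rec_bo_child rec_bo_dat).
move=> a b a' b' y h.
have h' i : (i <= proj (proj y 2) 0)%N -> a i = a' i /\ b i = b' i.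
  by move=> iy; apply: h; apply: leq_trans iy (leq_trans (proj_le _ _) (proj_le _ _)).
split; first by rewrite /bo_lab (node_local 0 h').1.
by apply: funext => t; rewrite /bo_dat (node_local _ h').2.
Qed.

Lemma tree_stage_BC (lab : nat -> nat) (child dat : nat -> nat -> nat) (W : rel nat) r z :
  tree_stage lab child W r z -> BC_stage R W r (tcode R lab child dat z).
Proof.
elim=> {r z} [r z r0 lz|r z y r0 lz yr _ IH].
  by apply: BC_stage_zero => //; rewrite tcode0.
apply: (@BC_stage_pos _ _ _ _ (fun n => tcode R lab child dat (child z n)) y) => //.
  by rewrite tcode0.
by move=> n; exact: tcode_child.
Qed.

Lemma tree_stageE lab child (W : rel nat) r z : tree_stage lab child W r z ->
  (ord_zero W r /\ lab z = 0%N) \/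
  exists y : nat -> nat, [/\ ~ ord_zero W r, lab z = 1%N,
    forall n, ord_lt W (y n) r & forall n, tree_stage lab child W (y n) (child z n)].
Proof. by case=> {r z} [r z ? ?|r z y ? ? ? ?]; [left|right; exists y]. Qed.

Definition above a u (C : set 'rV[R]_N) := forall x s, branch R N a s -> lims s x ->
  (forall i, (i < size u)%N -> (s i <= nth 0 u i)%N) -> C x.

Definition avoids b v (C : set 'rV[R]_N) := forall x s, branch R N b s -> lims s x ->
  (forall i, (i < size v)%N -> s i = nth 0%N v i) -> ~ C x.

(** The nodes of the Borel tree at which the set of [z] is coded through two alternations; the label
    condition removes the basic closed sets of leaves. *)
Definition carries a b z y :=
  [/\ proj y 0 != 1%N, bo_lab a b y = 1%N & proj y 1 = z].

Lemma bo_child2 a b z y i j : carries a b z y ->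
  bo_child (bo_child y i) j =
  seqcode [:: 0%N; cg_child z (seqcode [:: i; j]); seqcode [:: z; j]].
Proof.
move=> [y0 _ yz]; have -> : bo_child y i = seqcode [:: 1%N; z; i].
  by rewrite /bo_child (negPf y0) yz.
by rewrite /bo_child !proj_seqcode.
Qed.

Lemma carries_child a b z y i j : carries a b z y -> cg_lab a b z = 1%N ->
  carries a b (cg_child z (seqcode [:: i; j])) (bo_child (bo_child y i) j).
Proof.
move=> /bo_child2 -> /cg_lab1 lz.
by rewrite /carries /bo_lab !proj_seqcode /= lz.
Qed.

Lemma bo_lab_child a b z y i : carries a b z y -> bo_lab a b (bo_child y i) = 1%N.
Proof. by move=> [y0 _ _]; rewrite /bo_lab /bo_child (negPf y0) !proj_seqcode. Qed.

(** One induction treats separation and both codes, so that they concern the same set. The Borel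
    clause ranges over all nodes [y] that carry [z], since the root and inner nodes have different
    forms. *)
Lemma tree_set a b z : wf_tree (cg_lab a b) cg_child z ->
  forall u v, size u = size v -> z = node u v ->
  exists C : set 'rV[R]_N, [/\ convexly_generated C, above a u C, avoids b v C,
    (forall y, carries a b z y -> wf_tree (bo_lab a b) bo_child y /\
        borel_set_of RS (bo_code a b y) C) &
    forall (W : rel nat) r, tree_stage (cg_lab a b) cg_child W r z ->
      CGC_stage W r (cg_code a b z) C].
Proof.
elim=> {z} z lz => [|_ IH] u v uv ze.
  have lf : leaf R N a b (size u) (seqcode u) (seqcode v).
    by move: lz; rewrite /cg_lab /cg_leaf ze !proj_seqcode /=; case: ifP.
  have pE w : seqcode w = prefix (nth 0%N w) (size w) by rewrite /prefix mkseq_nth.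
  have FE : Fset RS (cg_dat a b z) = @leaf_set R N a (size u) (seqcode u) (seqcode v).
    rewrite -leaf_set_Fset; congr (Fset _ _); apply: funext => t.
    by rewrite /cg_dat ze !proj_seqcode.
  have kC := @compact_leaf_set R N a (size u) (seqcode u) (seqcode v).
  have cC := @convex_leaf_set R N a (size u) (seqcode u) (seqcode v).
  exists (@leaf_set R N a (size u) (seqcode u) (seqcode v)); split.
  - exact: cg_compact.
  - move=> x s sb sx su; move: lf; rewrite [seqcode u]pE => lf.
    exact: leaf_set_above lf sb sx su.
  - move=> x s sb sx sv; apply: leaf_set_disjoint lf sb sx _ => i iu.
    by rewrite proj_seqcode sv -?uv.
  - move=> y yz; have [y0 ly yE] := yz.
    have lz1 i j : bo_lab a b (bo_child (bo_child y i) j) = 0%N.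
      rewrite (bo_child2 _ _ yz) /bo_lab !proj_seqcode /=.
      by move: lz; rewrite /cg_lab; case: ifP.
    split.
      apply: wf_node => // i; apply: wf_node; first exact: bo_lab_child yz.
      by move=> j; apply: wf_leaf.
    (* A leaf set fits the same two Borel levels: the outer union is constant, and each grandchild
       codes the complement of a single ball. *)
    rewrite -FE; have -> : Fset RS (cg_dat a b z) =
        \bigcup_(i : nat) ~` \bigcup_j ~` ~` nball RS (cg_dat a b z j).
      rewrite bigcup_const; last by exists 0%N.
      by rewrite /Fset /Uset; congr (~` _); apply: eq_bigcupr => j _; rewrite setCK.
    apply: (@borel_set_of_one _ _ _ (fun i => bo_code a b (bo_child y i))).
    + by rewrite /bo_code tcode0.
    + by move=> n; exact: tcode_child.
    move=> i; apply: (@borel_set_of_one _ _ _ (fun j => bo_code a b (bo_child (bo_child y i) j))).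
    + by rewrite /bo_code tcode0 (bo_lab_child _ yz).
    + by move=> n; apply: tcode_child; exact: bo_lab_child yz.
    move=> j; have e : bo_code a b (bo_child (bo_child y i) j) 1%N = cg_dat a b z j.
      rewrite /bo_code tcode_leaf ?lz1 // /bo_dat.
      by rewrite (bo_child2 _ _ yz) !proj_seqcode.
    by rewrite -e; apply: borel_set_of_zero; rewrite /bo_code tcode0.
  - move=> W r /tree_stageE[[r0 _]|[y [_]]]; last by rewrite lz.
    have e : shift (cg_code a b z) = cg_dat a b z.
      by apply: funext => t; rewrite /shift /cg_code tcode_leaf // lz.
    rewrite -FE -e; apply: CGC_stage_zero => //; first by rewrite /cg_code tcode0.
    + by rewrite e FE.
    + by rewrite e FE.
pose kd (p : nat * nat) := node (rcons u p.1) (rcons v p.2).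
have kdE i j : cg_child z (seqcode [:: i; j]) = kd ((i + proj j 0)%N, proj j 1).
  by rewrite ze cg_child_node // !proj_seqcode.
(* The set is chosen per pair of new entries, not per index [<i, j>]: different indices leading to
   the same child must receive the same set for the monotonicity below. *)
have /choice[D hD] : forall p, exists C : set 'rV[R]_N,
    [/\ convexly_generated C, above a (rcons u p.1) C, avoids b (rcons v p.2) C,
    (forall y, carries a b (kd p) y -> wf_tree (bo_lab a b) bo_child y /\
        borel_set_of RS (bo_code a b y) C) &
    forall (W : rel nat) r, tree_stage (cg_lab a b) cg_child W r (kd p) ->
      CGC_stage W r (cg_code a b (kd p)) C].
  move=> p; have <- : cg_child z (seqcode [:: p.1; seqcode [:: 0%N; p.2]]) = kd p.
    by rewrite kdE !proj_seqcode /= addn0.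
  apply: IH; first by rewrite !size_rcons uv.
  by rewrite kdE /kd !proj_seqcode /= addn0.
pose E i j := D ((i + proj j 0)%N, proj j 1).
have Emon i i' : (i <= i')%N -> \bigcap_j E i j `<=` \bigcap_j E i' j.
  move=> ii' x Ex j _.
  (* From [i] this index reaches the same child as [j] does from [i']. *)
  have := Ex (seqcode [:: i' + proj j 0 - i; proj j 1])%N I; rewrite /E !proj_seqcode /=.
  by rewrite subnKC // (leq_trans ii') // leq_addr.
exists (\bigcup_i \bigcap_j E i j); split.
- apply: cg_union => // i; apply: cg_inter => j.
  by have [] := hD ((i + proj j 0)%N, proj j 1).
(* From [i = s (size u)] on, every child's new bound dominates the next entry of [s]. *)
- move=> x s sb sx su; exists (s (size u)) => // j _.
  have [_ + _ _ _] := hD ((s (size u) + proj j 0)%N, proj j 1); apply; [exact: sb|exact: sx|].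
  move=> i; rewrite size_rcons ltnS nth_rcons; case: ltngtP => //= [iu _|-> _].
    exact: su.
  exact: leq_addr.
- move=> x s sb sx sv [i _ Ex].
  (* Among the sets intersected at [i] is the one whose second sequence follows [s], and it already
     avoids [x]. *)
  have [_ _ h _ _] := hD (i, s (size v)); apply: (h x s sb sx).
    move=> k; rewrite size_rcons ltnS nth_rcons; case: ltngtP => //= [kv _|-> _] //.
    exact: sv.
  by have := Ex (seqcode [:: 0%N; s (size v)]) I; rewrite /E !proj_seqcode /= addn0.
- move=> y yz; have [_ ly _] := yz.
  have yc i j := hD ((i + proj j 0)%N, proj j 1).
  have yb i j : wf_tree (bo_lab a b) bo_child (bo_child (bo_child y i) j) /\
      borel_set_of RS (bo_code a b (bo_child (bo_child y i) j)) (E i j).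
    have [_ _ _ + _] := hD ((i + proj j 0)%N, proj j 1); apply.
    by rewrite -kdE; exact: carries_child.
  split.
    apply: wf_node => // i; apply: wf_node; first exact: bo_lab_child yz.
    by move=> j; case: (yb i j).
  have -> : \bigcup_i \bigcap_j E i j = \bigcup_i ~` \bigcup_j ~` E i j.
    by apply: eq_bigcupr => i _; rewrite setC_bigcup; apply: eq_bigcapr => j _; rewrite setCK.
  apply: (@borel_set_of_one _ _ _ (fun i => bo_code a b (bo_child y i))).
  + by rewrite /bo_code tcode0.
  + by move=> n; exact: tcode_child.
  move=> i; apply: (@borel_set_of_one _ _ _ (fun j => bo_code a b (bo_child (bo_child y i) j))).
  + by rewrite /bo_code tcode0 (bo_lab_child _ yz).
  + by move=> n; apply: tcode_child; exact: bo_lab_child yz.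
  by move=> j; case: (yb i j).
- move=> W r /tree_stageE[[_]|[y [r0 _ yr yst]]]; first by rewrite lz.
  apply: (@CGC_stage_pos _ _ _ _ _
    (fun i j => cg_code a b (cg_child z (seqcode [:: i; j])))
    (fun i j => y (seqcode [:: i; j]))) => //.
  + by rewrite /cg_code tcode0.
  + by move=> i j; exact: tcode_child.
  + move=> i j; rewrite kdE; have [_ _ _ _ h] := hD ((i + proj j 0)%N, proj j 1).
    by apply: h; rewrite -kdE.
Qed.

(* An infinite path through the tree would consist of the pairs of prefixes of two
   infinite sequences, none of them a leaf. *)
Lemma wf_root a b :
  (forall e d : baire, exists n, leaf R N a b n (prefix e n) (prefix d n)) ->
  wf_tree (cg_lab a b) cg_child root.
Proof.
move=> H; apply: contrapT => nwf.
pose T := (seq nat * seq nat)%type.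
pose bad (p : T) := size p.1 = size p.2 /\ ~ wf_tree (cg_lab a b) cg_child (node p.1 p.2).
have step (p : T) : exists kl : nat * nat, bad p ->
    cg_leaf a b (node p.1 p.2) = false /\ bad (rcons p.1 kl.1, rcons p.2 kl.2).
  have [[sp np]|//] := pselect (bad p); last by exists (0%N, 0%N).
  have nl : cg_leaf a b (node p.1 p.2) = false.
    by apply/negP => lf; apply: np; apply: wf_leaf; rewrite /cg_lab lf.
  have [m hm] : exists m, ~ wf_tree (cg_lab a b) cg_child (cg_child (node p.1 p.2) m).
    apply: contrapT => /forallNP h; apply: np; apply: wf_node; first by rewrite /cg_lab nl.
    by move=> m; exact: (contrapT (h m)).
  exists ((proj m 0 + proj (proj m 1) 0)%N, proj (proj m 1) 1) => _.
  by split=> //; split; rewrite /= ?size_rcons ?sp // -cg_child_node.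
have /choice[g hg] := step.
pose P := fix P n : T :=
  if n is n'.+1 then (rcons (P n').1 (g (P n')).1, rcons (P n').2 (g (P n')).2)
  else ([::], [::]).
have bP n : bad (P n).
  elim: n => [|n IH]; first by split.
  by have [] := hg _ IH.
pose e n := (g (P n)).1; pose d n := (g (P n)).2.
have PE n : P n = (mkseq e n, mkseq d n).
  by elim: n => //= n IH; rewrite IH !mkseqS /e /d IH.
have [n hn] := H e d; have [+ _] := hg _ (bP n).
by rewrite PE /cg_leaf /node !proj_seqcode /= size_mkseq -!/(prefix _ _) hn.
Qed.

End Trees.

Theorem theorem1p5 (R : realType) (N : nat) (hN : (1 <= N)%N) :
  exists u v : pprod (BaireSpace R) (BaireSpace R) -> BaireSpace R,
    Delta11_recursive u /\ Delta11_recursive v /\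
    forall alpha beta : baire,
      G1set (RealSpace R N) alpha `&` G1set (RealSpace R N) beta = set0 ->
      convex_set (G1set (RealSpace R N) alpha : set 'rV[R]_N) ->
      exists C : set 'rV[R]_N,
        convexly_generated C /\
        G1set (RealSpace R N) alpha `<=` C /\
        C `&` G1set (RealSpace R N) beta = set0 /\
        Borel_code (RealSpace R N) (u (alpha, beta)) C /\
        CG_code (v (alpha, beta)) C.
Proof.
exists (fun z => bo_code R N z.1 z.2 bo_root), (fun z => cg_code R N z.1 z.2 root).
split; first exact: Delta11_bo_code.
split; first exact: Delta11_cg_code.
move=> a b ab0 ca /=.
have wfr : wf_tree (cg_lab R N a b) cg_child root.
  by apply: wf_root => e d; exact: leaf_exists.
have [C [cgC Ca Cb Cbo Ccg]] := tree_set wfr (erefl : size [::] = size [::]) erefl.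
have rc : carries R N a b root bo_root.
  by split; rewrite /bo_lab /bo_root !proj_seqcode.
have [wfb Cborel] := Cbo _ rc.
exists C; split=> //; split.
  by move=> x /G1set_branch[s sb sx]; exact: (Ca x s sb sx).
split.
  apply/seteqP; split=> // x [Cx /G1set_branch[s sb sx]].
  exact: (Cb x s sb sx).
split.
  split=> //; have [W [wo [r hr]]] := wf_tree_stage wfb.
  by exists W; split=> //; exists r; exact: tree_stage_BC.
have [W [wo [r hr]]] := wf_tree_stage wfr.
by exists W; split=> //; exists r; exact: Ccg.
Qed.
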